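(* Work in ZFU (the ambient universe $U$). Let $\mathcal{G}$ be a group of permutations of a set of urelements, $\mathcal{F}$ a normal filter on $\mathcal{G}$, $\mathcal{I}$ a $\mathcal{G}$-flexible ideal, and $M=\{x : x\text{ is hereditarily }\mathcal{F}\text{-symmetric and }\ker(x)\in\mathcal{I}\}$ the small-kernel permutation model. Then (1) $M\models$ ZFU; and (2) if AC holds in $U$ and $M\models$ ''there is a universal set'', then $M\models$ SVC.
   Context: ZFU: language $\in$ plus a unary predicate $\mathcal{A}$ for urelements; axioms Foundation, Pairing, Union, Powerset, Infinity, Separation, Replacement, Extensionality for sets, urelements have no members; a proper class of urelements allowed; no Choice. $\ker(x)$ is the set of urelements in the transitive closure of $\{x\}$. A permutation $\pi$ of a set of urelements acts on all objects by fixing urelements outside its domain and $\pi x=\{\pi y: y\in x\}$ for sets $x$. For $\mathcal{G}$ a group of permutations of a set $A$ of urelements: $\mathrm{sym}_{\mathcal G}(x)=\{\pi\in\mathcal G:\pi x=x\}$, $\mathrm{fix}_{\mathcal G}(x)=\{\pi\in\mathcal G:\pi y=y\text{ for all }y\in x\}$. A normal filter $\mathcal F$ on $\mathcal G$ is a nonempty set of subgroups of $\mathcal G$ containing $\mathrm{sym}_{\mathcal G}(a)$ for every urelement $a$, closed under supergroups, finite intersections and conjugation by elements of $\mathcal G$. $x$ is $\mathcal F$-symmetric if $\mathrm{sym}_{\mathcal G}(x)\in\mathcal F$, hereditarily $\mathcal F$-symmetric if every $y\in\mathrm{tc}(\{x\})$ is $\mathcal F$-symmetric. An ideal $\mathcal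 I$ (a set of sets of urelements) is $\mathcal G$-flexible if (i) it is closed under subsets and finite unions, (ii) $\pi\mathcal I=\mathcal I$ for all $\pi\in\mathcal G$, and (iii) whenever $B\cup\{a\}\in\mathcal I$ and $a\notin B$, there is $\pi\in\mathrm{fix}_{\mathcal G}(B)$ with $\pi a\ne a$. A set $A$ of urelements is universal if every set of urelements injects into $V(A)=\bigcup_\alpha V_\alpha(A)$ ($V_0(A)=A$, $V_{\alpha+1}(A)=P(V_\alpha(A))\cup A$, unions at limits). SVC: there is a set $S$ such that for every set $x$ there is an ordinal $\alpha$ and a surjection from $S\times\alpha$ onto $x$ (or $x=\emptyset$). *)

(* Defs.v *)
(** First-order set theory with urelements.  A structure interprets membership
    and the urelement predicate; [sat] is Tarskian satisfaction and is what
    indexes the two axiom schemas.  All other set-theoretic notions are written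
    directly as the truth condition of their defining formula in an arbitrary
    structure [M]: every quantifier ranges over [M], so that a predicate applied
    to a substructure is the relativized ("M satisfies ...") notion. *)

Set Implicit Arguments.
Unset Strict Implicit.

Record structure : Type := Structure {
  carrier :> Type;
  mem : carrier -> carrier -> Prop;
  ur : carrier -> Prop
}.

Arguments mem {s} _ _.
Arguments ur {s} _.

Declare Scope zfu_scope.
Open Scope zfu_scope.
Notation "x ∈ y" := (mem x y) (at level 70, no associativity) : zfu_scope.

Definition substructure (U : structure) (P : U -> Prop) : structure :=
  {| carrier := {x : U | P x};
     mem := fun x y => proj1_sig x ∈ proj1_sig y;
     ur := fun x => ur (proj1_sig x) |}.

(** ** Formulas, with de Bruijn indices *)

Inductive formula : Type :=
| fmem (i j : nat)
| feq (i j : nat)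
| fur (i : nat)
| fbot
| fimp (p q : formula)
| fall (p : formula).

Definition scons (X : Type) (x : X) (e : nat -> X) (n : nat) : X :=
  match n with 0 => x | S k => e k end.

Fixpoint sat (M : structure) (e : nat -> M) (p : formula) : Prop :=
  match p with
  | fmem i j => e i ∈ e j
  | feq i j => e i = e j
  | fur i => ur (e i)
  | fbot => False
  | fimp p q => sat e p -> sat e q
  | fall p => forall x : M, sat (scons x e) p
  end.

(** ** Basic notions *)

Definition is_set (M : structure) (x : M) : Prop := ~ ur x.

Definition subset (M : structure) (x y : M) : Prop :=
  forall z : M, z ∈ x -> z ∈ y.
Notation "x ⊆ y" := (subset x y) (at level 70, no associativity) : zfu_scope.

Definition is_empty (M : structure) (x : M) : Prop :=
  is_set x /\ forall z : M, ~ z ∈ x.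

Definition is_set_of_ur (M : structure) (x : M) : Prop :=
  is_set x /\ forall a : M, a ∈ x -> ur a.

Definition is_upair (M : structure) (p x y : M) : Prop :=
  is_set p /\ forall w : M, w ∈ p <-> w = x \/ w = y.

Definition is_union2 (M : structure) (u x y : M) : Prop :=
  is_set u /\ forall w : M, w ∈ u <-> w ∈ x \/ w ∈ y.

Definition is_inter2 (M : structure) (u x y : M) : Prop :=
  is_set u /\ forall w : M, w ∈ u <-> w ∈ x /\ w ∈ y.

(** [y = x ∪ {a}] *)
Definition is_adjoin (M : structure) (y x a : M) : Prop :=
  is_set y /\ forall w : M, w ∈ y <-> w ∈ x \/ w = a.

Definition is_succ (M : structure) (y x : M) : Prop := is_adjoin y x x.

(** Kuratowski pairs *)
Definition is_opair (M : structure) (p x y : M) : Prop :=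
  exists s t : M, is_upair s x x /\ is_upair t x y /\ is_upair p s t.

Definition is_prod (M : structure) (d x y : M) : Prop :=
  is_set d /\
  forall p : M, p ∈ d <-> exists a b : M, a ∈ x /\ b ∈ y /\ is_opair p a b.

(** ** Relations and functions, as sets of ordered pairs *)

Definition is_rel (M : structure) (f : M) : Prop :=
  is_set f /\ forall p : M, p ∈ f -> exists x y : M, is_opair p x y.

Definition maps (M : structure) (f x y : M) : Prop :=
  exists p : M, p ∈ f /\ is_opair p x y.

Definition is_function (M : structure) (f : M) : Prop :=
  is_rel f /\ forall x y y' : M, maps f x y -> maps f x y' -> y = y'.

Definition is_dom (M : structure) (f d : M) : Prop :=
  is_set d /\ forall x : M, x ∈ d <-> exists y : M, maps f x y.

Definition function_on (M : structure) (f d : M) : Prop :=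
  is_function f /\ is_dom f d.

Definition injective (M : structure) (f : M) : Prop :=
  forall x x' y : M, maps f x y -> maps f x' y -> x = x'.

Definition onto (M : structure) (f y : M) : Prop :=
  forall v : M, v ∈ y <-> exists x : M, maps f x v.

(** [h = f ∘ g] *)
Definition is_comp (M : structure) (h f g : M) : Prop :=
  is_rel h /\
  forall x z : M, maps h x z <-> exists y : M, maps g x y /\ maps f y z.

Definition is_inverse (M : structure) (g f : M) : Prop :=
  is_rel g /\ forall x y : M, maps g x y <-> maps f y x.

Definition is_identity (M : structure) (e d : M) : Prop :=
  is_rel e /\ forall x y : M, maps e x y <-> x ∈ d /\ x = y.

(** ** Transitive sets, ordinals, kernels *)

Definition transitive (M : structure) (x : M) : Prop :=
  is_set x /\ forall y : M, y ∈ x -> y ⊆ x.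

(** By Foundation this is the usual notion; [transitive] excludes urelements. *)
Definition is_ordinal (M : structure) (x : M) : Prop :=
  transitive x /\ forall y : M, y ∈ x -> transitive y.

Definition is_limit (M : structure) (x : M) : Prop :=
  is_ordinal x /\ ~ is_empty x /\ ~ exists y : M, is_succ x y.

Definition is_tc (M : structure) (t x : M) : Prop :=
  transitive t /\ x ⊆ t /\ forall s : M, transitive s -> x ⊆ s -> t ⊆ s.

(** [y ∈ tc({x})] *)
Definition in_tc_singleton (M : structure) (y x : M) : Prop :=
  exists s t : M, is_upair s x x /\ is_tc t s /\ y ∈ t.

Definition is_ker (M : structure) (k x : M) : Prop :=
  is_set k /\ forall a : M, a ∈ k <-> ur a /\ in_tc_singleton a x.

(** ** The axioms *)

Record ZFU (M : structure) : Prop := {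
  zfu_urelements : forall a x : M, ur a -> ~ x ∈ a;
  zfu_extensionality : forall x y : M, is_set x -> is_set y ->
    (forall z : M, z ∈ x <-> z ∈ y) -> x = y;
  zfu_foundation : forall x : M, (exists y : M, y ∈ x) ->
    exists y : M, y ∈ x /\ ~ exists z : M, z ∈ x /\ z ∈ y;
  zfu_pairing : forall x y : M, exists p : M, is_upair p x y;
  zfu_union : forall x : M, exists u : M, is_set u /\
    forall z : M, z ∈ u <-> exists y : M, y ∈ x /\ z ∈ y;
  zfu_powerset : forall x : M, is_set x -> exists u : M, is_set u /\
    forall z : M, z ∈ u <-> is_set z /\ z ⊆ x;
  zfu_infinity : exists x : M, is_set x /\
    (exists z : M, is_empty z /\ z ∈ x) /\
    (forall y : M, y ∈ x -> exists z : M, is_succ z y /\ z ∈ x);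
  zfu_separation : forall (p : formula) (e : nat -> M) (x : M),
    exists y : M, is_set y /\
      forall z : M, z ∈ y <-> z ∈ x /\ sat (scons z e) p;
  (* in [p], index 0 is the value and index 1 the argument *)
  zfu_replacement : forall (p : formula) (e : nat -> M) (x : M),
    (forall z : M, z ∈ x -> exists! w : M, sat (scons w (scons z e)) p) ->
    exists y : M, is_set y /\
      forall w : M, w ∈ y <->
        exists z : M, z ∈ x /\ sat (scons w (scons z e)) p
}.

Definition AC (M : structure) : Prop :=
  forall x : M, is_set x ->
    (forall y : M, y ∈ x -> exists z : M, z ∈ y) ->
    exists f : M, function_on f x /\
      forall y z : M, y ∈ x -> maps f y z -> z ∈ y.

Definition SVC (M : structure) : Prop :=
  exists S : M, is_set S /\
    forall x : M, is_set x ->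
      is_empty x \/
      exists α d f : M,
        is_ordinal α /\ is_prod d S α /\ function_on f d /\ onto f x.

(** ** The hierarchy [V_α(A)] and universal sets *)

(** [f] is an initial segment of the sequence [α ↦ V_α(A)]. *)
Definition is_V_sequence (M : structure) (A f : M) : Prop :=
  is_function f /\
  (exists δ : M, is_ordinal δ /\ is_dom f δ) /\
  forall β v : M, maps f β v ->
    (is_empty β -> v = A) /\
    (forall γ u : M, is_succ β γ -> maps f γ u ->
       is_set v /\ forall z : M, z ∈ v <-> (is_set z /\ z ⊆ u) \/ z ∈ A) /\
    (is_limit β ->
       is_set v /\
       forall z : M, z ∈ v <->
         exists γ u : M, γ ∈ β /\ maps f γ u /\ z ∈ u).

Definition is_V_level (M : structure) (A α v : M) : Prop :=
  exists f : M, is_V_sequence A f /\ maps f α v.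

Definition in_V (M : structure) (A x : M) : Prop :=
  exists α v : M, is_V_level A α v /\ x ∈ v.

Definition universal (M : structure) (A : M) : Prop :=
  is_set_of_ur A /\
  forall B : M, is_set_of_ur B ->
    exists f : M, function_on f B /\ injective f /\
      forall b v : M, maps f b v -> in_V A v.

Definition has_universal_set (M : structure) : Prop :=
  exists A : M, universal A.

(** ** Permutations of urelements and their action *)

Definition is_permutation (M : structure) (A π : M) : Prop :=
  function_on π A /\ injective π /\ onto π A.

(** The action is defined by ∈-recursion: [f] is an approximation to it,
    satisfying the recursion equations on a transitive domain. *)
Definition is_action_approx (M : structure) (π f : M) : Prop :=
  is_function f /\
  (exists d : M, transitive d /\ is_dom f d) /\
  forall z w : M, maps f z w ->
    (ur z -> maps π z w \/ (~ (exists v : M, maps π z v) /\ w = z)) /\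
    (is_set z ->
       is_set w /\ forall v : M, v ∈ w <-> exists u : M, u ∈ z /\ maps f u v).

(** [π x = y] *)
Definition acts (M : structure) (π x y : M) : Prop :=
  exists f : M, is_action_approx π f /\ maps f x y.

Definition permutation_group (M : structure) (A G : M) : Prop :=
  is_set_of_ur A /\
  is_set G /\
  (forall π : M, π ∈ G -> is_permutation A π) /\
  (exists e : M, is_identity e A /\ e ∈ G) /\
  (forall π σ : M, π ∈ G -> σ ∈ G -> exists ρ : M, is_comp ρ π σ /\ ρ ∈ G) /\
  (forall π : M, π ∈ G -> exists ρ : M, is_inverse ρ π /\ ρ ∈ G).

Definition subgroup (M : structure) (A H G : M) : Prop :=
  permutation_group A H /\ H ⊆ G.

Definition in_sym (M : structure) (G x π : M) : Prop :=
  π ∈ G /\ acts π x x.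

Definition in_fix (M : structure) (G x π : M) : Prop :=
  π ∈ G /\ forall y : M, y ∈ x -> acts π y y.

Definition is_sym (M : structure) (G x s : M) : Prop :=
  is_set s /\ forall π : M, π ∈ s <-> in_sym G x π.

(** [ρ = π σ π⁻¹] *)
Definition is_conjugate (M : structure) (ρ π σ : M) : Prop :=
  exists i t : M, is_inverse i π /\ is_comp t π σ /\ is_comp ρ t i.

(** [K = π H π⁻¹] *)
Definition is_conjugate_set (M : structure) (K π H : M) : Prop :=
  is_set K /\
  forall ρ : M, ρ ∈ K <-> exists σ : M, σ ∈ H /\ is_conjugate ρ π σ.

Record normal_filter (M : structure) (A G F : M) : Prop := {
  nf_set : is_set F;
  nf_nonempty : exists H : M, H ∈ F;
  nf_subgroup : forall H : M, H ∈ F -> subgroup A H G;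
  nf_sym : forall a : M, ur a -> exists s : M, is_sym G a s /\ s ∈ F;
  nf_super : forall H K : M, H ∈ F -> subgroup A K G -> H ⊆ K -> K ∈ F;
  nf_inter : forall H K : M, H ∈ F -> K ∈ F ->
    exists L : M, is_inter2 L H K /\ L ∈ F;
  nf_conj : forall H π : M, H ∈ F -> π ∈ G ->
    exists K : M, is_conjugate_set K π H /\ K ∈ F
}.

(** Closure under finite unions includes the empty union. *)
Record flexible_ideal (M : structure) (G I : M) : Prop := {
  fi_set : is_set I;
  fi_ur : forall X : M, X ∈ I -> is_set_of_ur X;
  fi_subset : forall X Y : M, X ∈ I -> is_set Y -> Y ⊆ X -> Y ∈ I;
  fi_empty : exists X : M, is_empty X /\ X ∈ I;
  fi_union : forall X Y : M, X ∈ I -> Y ∈ I ->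
    exists Z : M, is_union2 Z X Y /\ Z ∈ I;
  fi_invariant : forall π : M, π ∈ G -> acts π I I;
  fi_flexible : forall B a C : M,
    is_set B -> is_adjoin C B a -> C ∈ I -> ~ a ∈ B ->
    exists π b : M, in_fix G B π /\ acts π a b /\ b <> a
}.

(** ** Small-kernel permutation models *)

Definition symmetric (M : structure) (G F x : M) : Prop :=
  exists s : M, is_sym G x s /\ s ∈ F.

Definition hereditarily_symmetric (M : structure) (G F x : M) : Prop :=
  forall y : M, in_tc_singleton y x -> symmetric G F y.

Definition in_small_kernel_model (U : structure) (G F I x : U) : Prop :=
  hereditarily_symmetric G F x /\ exists k : U, is_ker k x /\ k ∈ I.

Definition small_kernel_model (U : structure) (G F I : U) : structure :=
  substructure (in_small_kernel_model G F I).

(* Main.v *)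
(** Every permutation in [G] acts as an automorphism of [U] that preserves [M], so a set
    defined in [M] from parameters is symmetric.  Its kernel is small by flexibility: an
    object [w] of [M] defined from parameters with kernel included in [k ∈ I] has
    [ker w ⊆ k], for otherwise some [a ∈ ker w] outside [k] could be moved while [k] and
    the rest of [ker w], hence [w], stay fixed.  This gives Replacement in [M].

    For SVC, let [E] be universal in [M].  By Scott's trick, which works below a fixed
    kernel, some set [S ∈ M] contains, for every [t ∈ M] with [ker t ⊆ E], an element
    with the same stabilizer as [t].  Given [x ∈ M], an injection [f ∈ M] of [ker x]
    into [V(E)] lifts to an injective coding [j] of the elements of [x] by objects with
    kernel included in [E].  Using AC, list the pairs [(y, t) ∈ x × S] with
    [sym t = sym (j y)] as [(y_i, t_i)], for [i] in an ordinal [o]; with [H ∈ F] fixing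
    [x], [f] and [S], the assignment [(π t_i, i) ↦ π y_i], for [π ∈ H], is a well-defined
    partial surjection in [M] from [S × o] onto [x]. *)

From Stdlib Require Import Arith Lia.
From Stdlib Require Import Classical ClassicalEpsilon FunctionalExtensionality ProofIrrelevance.
Require Import Defs.

Set Implicit Arguments.
Unset Strict Implicit.

(** Separation and Replacement accept formulas only, so every set formed in [U] must come with one.
    The predicate [definable] hides the syntax: closure under connectives, quantifiers and definable
    functions is proved once, recursion along membership stays within it, and the resulting side
    conditions are left to proof search.

    The existence of [S] rests on the fact that the stabilizers of objects of the model all lie in
    [F], which is a set: one collects over the members of [F] instead of over a proper class of
    objects [t].

    The obstacle in the coding is that the values of the injection into V(E) may be sets, so the
    value at an urelement could coincide with the code of some set. Each code of a set therefore
    receives an extra member, a pure set that occurs nowhere below [f]; purity makes it invariant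
    under all permutations and keeps it out of kernels.

    Choice is available in [U] only, so the listing of pairs is made there. The model sees of it
    just an ordinal, which is pure, and whole orbits, which are symmetric. *)

Fixpoint ren (r : nat -> nat) (p : formula) : formula :=
  match p with
  | fmem i j => fmem (r i) (r j)
  | feq i j => feq (r i) (r j)
  | fur i => fur (r i)
  | fbot => fbot
  | fimp p q => fimp (ren r p) (ren r q)
  | fall p => fall (ren (fun n => match n with 0 => 0 | S k => S (r k) end) p)
  end.

Lemma sat_ext (M : structure) (p : formula) (e e' : nat -> M) :
  (forall n, e n = e' n) -> sat e p <-> sat e' p.
Proof.
  intros H; rewrite (functional_extensionality e e' H); reflexivity.
Qed.

Lemma sat_ren (M : structure) (p : formula) (r : nat -> nat) (e : nat -> M) :
  sat e (ren r p) <-> sat (fun n => e (r n)) p.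
Proof.
  revert r e; induction p as [| | | |p IHp q IHq|p IHp]; intros r e; simpl;
    try reflexivity.
  - rewrite IHp, IHq; reflexivity.
  - assert (E : forall x, (fun n => scons x e (match n with 0 => 0 | S k => S (r k) end))
                          = scons x (fun n => e (r n))).
    { intros x; apply functional_extensionality; intros [|n]; reflexivity. }
    split; intros H x; specialize (H x); rewrite IHp, E in *; exact H.
Qed.

(** * Definability with parameters *)

Definition tail (X : Type) (e : nat -> X) (n : nat) : X := e (S n).

(** Interleaving leaves infinitely many slots both for the variables and for the parameters, so
    definable predicates can be combined without bounding the variables of their formulas. *)
Definition join (X : Type) (e c : nat -> X) (n : nat) : X :=
  if Nat.even n then e (Nat.div2 n) else c (Nat.div2 n).

Lemma join_even (X : Type) (e c : nat -> X) (n : nat) : join e c (2 * n) = e n.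
Proof.
  unfold join. rewrite Nat.even_even, Nat.div2_double. reflexivity.
Qed.

Lemma join_odd (X : Type) (e c : nat -> X) (n : nat) : join e c (S (2 * n)) = c n.
Proof.
  unfold join. rewrite Nat.even_succ, Nat.odd_even, Nat.div2_succ_double. reflexivity.
Qed.

Lemma parity_cases (n : nat) : (exists m, n = 2 * m) \/ (exists m, n = S (2 * m)).
Proof.
  destruct (Nat.Even_or_Odd n) as [[m H]|[m H]]; [left|right]; exists m; lia.
Qed.

Section Definability.
Context {U : structure}.

(** [P] is definable with parameters: the even variables of the formula range
    over the context of [P], the odd ones hold the parameters.  The premise [U] makes
    the notion trivial in the empty structure, where no parameters exist. *)
Definition definable (P : (nat -> U) -> Prop) : Prop :=
  U -> exists (q : formula) (c : nat -> U), forall e, P e <-> sat (join e c) q.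

Definition definable_term (t : (nat -> U) -> U) : Prop :=
  definable (fun e => e 0 = t (tail e)).

Lemma definable_iff (P Q : (nat -> U) -> Prop) :
  (forall e, P e <-> Q e) -> definable Q -> definable P.
Proof.
  intros H HQ u; destruct (HQ u) as (q & c & Hq); exists q, c; intros e; rewrite H; apply Hq.
Qed.

(** Covers renaming of variables ([inl]) and specialization to constants ([inr]) at once. *)
Lemma definable_subst (P : (nat -> U) -> Prop) (s : nat -> nat + U) :
  definable P ->
  definable (fun e => P (fun n => match s n with inl m => e m | inr x => x end)).
Proof.
  intros HP u; destruct (HP u) as (q & c & Hq).
  (* The new parameters interleave the old ones with the constants of [s]: old parameter [m] becomes
     parameter [2 * m], and the constant for variable [m] becomes parameter [2 * m + 1]. *)
  set (r := fun k => if Nat.even k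
    then match s (Nat.div2 k) with inl m => 2 * m | inr _ => S (2 * (S (2 * Nat.div2 k))) end
    else S (2 * (2 * Nat.div2 k))).
  exists (ren r q), (join c (fun n => match s n with inl _ => c 0 | inr x => x end)).
  intros e. rewrite Hq, sat_ren.
  apply sat_ext.
  intros k; unfold r.
  destruct (parity_cases k) as [[m ->]|[m ->]].
  - rewrite join_even, Nat.even_even, Nat.div2_double.
    destruct (s m) as [i|x] eqn:E.
    + rewrite join_even; reflexivity.
    + rewrite !join_odd, E; reflexivity.
  - rewrite join_odd, Nat.even_succ, Nat.odd_even, Nat.div2_succ_double.
    rewrite join_odd, join_even. reflexivity.
Qed.

(** The two formulas come with separate parameter sequences; interleaving these gives a common one,
    as a binary connective requires. *)
Lemma definable_pair (P Q : (nat -> U) -> Prop) :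
  definable P -> definable Q -> U ->
  exists (p q : formula) (c : nat -> U),
    (forall e, P e <-> sat (join e c) p) /\ (forall e, Q e <-> sat (join e c) q).
Proof.
  intros HP HQ u; destruct (HP u) as (p & c & Hp), (HQ u) as (q & d & Hq).
  exists (ren (fun k => if Nat.even k then k else S (2 * (2 * Nat.div2 k))) p).
  exists (ren (fun k => if Nat.even k then k else S (2 * S (2 * Nat.div2 k))) q).
  exists (join c d). split; intros e; [rewrite Hp|rewrite Hq]; rewrite sat_ren;
    apply sat_ext; intros k;
    destruct (parity_cases k) as [[m ->]|[m ->]].
  - rewrite Nat.even_even, !join_even; reflexivity.
  - rewrite Nat.even_succ, Nat.odd_even, Nat.div2_succ_double, !join_odd, join_even.
    reflexivity.
  - rewrite Nat.even_even, !join_even; reflexivity.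
  - rewrite Nat.even_succ, Nat.odd_even, Nat.div2_succ_double, !join_odd.
    reflexivity.
Qed.

Lemma definable_imp (P Q : (nat -> U) -> Prop) :
  definable P -> definable Q -> definable (fun e => P e -> Q e).
Proof.
  intros HP HQ u. destruct (definable_pair HP HQ u) as (p & q & c & Hp & Hq).
  exists (fimp p q), c; intros e; simpl. rewrite Hp, Hq; reflexivity.
Qed.

Lemma definable_all (P : U -> (nat -> U) -> Prop) :
  definable (fun e => P (e 0) (tail e)) -> definable (fun e => forall x, P x e).
Proof.
  intros HP u; destruct (HP u) as (q & c & Hq).
  (* Under the binder the bound object is variable 0 and [join e c] starts at 1. Hence the context
     variable [2 * S m] moves down to [S (2 * m)], while every parameter moves up by one. *)
  exists (fall (ren (fun k => match k with 0 => 0 | S 0 => 2 | S (S m) =>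
      if Nat.even k then S m else S k end) q)), c.
  intros e; simpl.
  assert (E : forall x, P x e <-> sat (scons x (join e c))
     (ren (fun k => match k with 0 => 0 | S 0 => 2 | S (S m) =>
      if Nat.even k then S m else S k end) q)).
  { intros x. specialize (Hq (scons x e)). simpl in Hq.
    change (tail (scons x e)) with e in Hq. rewrite Hq, sat_ren.
    apply sat_ext.
    intros k. destruct (parity_cases k) as [[m ->]|[m ->]].
    - rewrite join_even. destruct m as [|m]; [reflexivity|].
      replace (2 * S m) with (S (S (2 * m))) by lia.
      change (Nat.even (S (S (2 * m)))) with (Nat.even (2 * m)).
      rewrite Nat.even_even. simpl scons. symmetry; apply join_even.
    - rewrite join_odd. destruct m as [|m]; [reflexivity|].
      replace (S (2 * S m)) with (S (S (S (2 * m)))) by lia.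
      change (Nat.even (S (S (S (2 * m))))) with (Nat.even (S (2 * m))).
      rewrite Nat.even_succ, Nat.odd_even. simpl scons.
      replace (S (S (S (m + (m + 0))))) with (S (2 * S m)) by lia.
      symmetry; apply join_odd. }
  split; intros H x; apply E; auto.
Qed.

Lemma definable_bot : definable (fun _ => False).
Proof. intros u; exists fbot, (fun _ => u); reflexivity. Qed.

Lemma definable_mem_var (i j : nat) : definable (fun e => e i ∈ e j).
Proof.
  intros u; exists (fmem (2 * i) (2 * j)), (fun _ => u); intros e.
  cbv beta iota delta [sat]; rewrite !join_even; reflexivity.
Qed.

Lemma definable_eq_var (i j : nat) : definable (fun e => e i = e j).
Proof.
  intros u; exists (feq (2 * i) (2 * j)), (fun _ => u); intros e.
  cbv beta iota delta [sat]; rewrite !join_even; reflexivity.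
Qed.

Lemma definable_ur_var (i : nat) : definable (fun e => ur (e i)).
Proof.
  intros u; exists (fur (2 * i)), (fun _ => u); intros e.
  cbv beta iota delta [sat]; rewrite !join_even; reflexivity.
Qed.

Lemma definable_not (P : (nat -> U) -> Prop) :
  definable P -> definable (fun e => ~ P e).
Proof. intros HP; exact (definable_imp HP definable_bot). Qed.

(** Formulas are built from falsity, implication and universal quantification; the other connectives
    are recovered classically. *)
Lemma definable_and (P Q : (nat -> U) -> Prop) :
  definable P -> definable Q -> definable (fun e => P e /\ Q e).
Proof.
  intros HP HQ.
  apply (@definable_iff _ (fun e => ~ (P e -> ~ Q e))); [intros e; tauto|].
  apply definable_not, definable_imp; [|apply definable_not]; assumption.
Qed.

Lemma definable_or (P Q : (nat -> U) -> Prop) :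
  definable P -> definable Q -> definable (fun e => P e \/ Q e).
Proof.
  intros HP HQ.
  apply (@definable_iff _ (fun e => ~ P e -> Q e)); [intros e; tauto|].
  apply definable_imp; [apply definable_not|]; assumption.
Qed.

Lemma definable_equiv (P Q : (nat -> U) -> Prop) :
  definable P -> definable Q -> definable (fun e => P e <-> Q e).
Proof.
  intros HP HQ; apply definable_and; apply definable_imp; assumption.
Qed.

Lemma definable_ex (P : U -> (nat -> U) -> Prop) :
  definable (fun e => P (e 0) (tail e)) -> definable (fun e => exists x, P x e).
Proof.
  intros HP.
  apply (@definable_iff _ (fun e => ~ forall x, ~ P x e)).
  - intros e; split; [intros [x Hx] N; exact (N x Hx)|].
    intros N; apply NNPP; intros M; apply N; intros x Hx; apply M; exists x; exact Hx.
  - apply definable_not.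
    exact (@definable_all (fun x e => ~ P x e) (definable_not HP)).
Qed.

Lemma definable_var (n : nat) : definable_term (fun e => e n).
Proof. exact (definable_eq_var 0 (S n)). Qed.

Lemma definable_const (c : U) : definable_term (fun _ => c).
Proof.
  exact (@definable_subst (fun e => e 0 = e 1)
           (fun n => match n with 0 => inl 0 | _ => inr c end) (definable_eq_var 0 1)).
Qed.

Lemma definable_term_shift (t : (nat -> U) -> U) :
  definable_term t -> definable_term (fun e => t (tail e)).
Proof.
  exact (@definable_subst (fun e => e 0 = t (tail e))
           (fun n => match n with 0 => inl 0 | S k => inl (S (S k)) end)).
Qed.

(** Formulas have no function symbols: a definable function is inserted into a predicate by
    quantifying over its value. *)
Lemma definable_app1 (P : U -> Prop) (t : (nat -> U) -> U) :
  definable (fun e => P (e 0)) -> definable_term t -> definable (fun e => P (t e)).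
Proof.
  intros HP Ht.
  apply (@definable_iff _ (fun e => exists x, x = t e /\ P x)).
  { intros e; split; [eauto | intros (x & -> & H); exact H]. }
  apply (@definable_ex (fun x e => x = t e /\ P x)).
  apply definable_and; [exact Ht|exact HP].
Qed.

Lemma definable_app2 (P : U -> U -> Prop) (t s : (nat -> U) -> U) :
  definable (fun e => P (e 0) (e 1)) -> definable_term t -> definable_term s ->
  definable (fun e => P (t e) (s e)).
Proof.
  intros HP Ht Hs.
  apply (@definable_iff _ (fun e => exists y, y = s e /\ exists x, x = t e /\ P x y)).
  { intros e; split; [eauto | intros (y & -> & x & -> & H); exact H]. }
  apply (@definable_ex (fun y e => y = s e /\ exists x, x = t e /\ P x y)).
  apply definable_and; [exact Hs|].
  apply (@definable_ex (fun x e => x = t (tail e) /\ P x (e 0))).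
  apply definable_and; [exact (definable_term_shift Ht)|exact HP].
Qed.

Lemma definable_app3 (P : U -> U -> U -> Prop) (t s r : (nat -> U) -> U) :
  definable (fun e => P (e 0) (e 1) (e 2)) ->
  definable_term t -> definable_term s -> definable_term r ->
  definable (fun e => P (t e) (s e) (r e)).
Proof.
  intros HP Ht Hs Hr.
  apply (@definable_iff _
    (fun e => exists z, z = r e /\ exists y, y = s e /\ exists x, x = t e /\ P x y z)).
  { intros e; split; [eauto 7 | intros (z & -> & y & -> & x & -> & H); exact H]. }
  apply (@definable_ex (fun z e => z = r e /\ exists y, y = s e /\ exists x, x = t e /\ P x y z)).
  apply definable_and; [exact Hr|].
  apply (@definable_ex (fun y e => y = s (tail e) /\ exists x, x = t (tail e) /\ P x y (e 0))).
  apply definable_and; [exact (definable_term_shift Hs)|].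
  apply (@definable_ex (fun x e => x = t (tail (tail e)) /\ P x (e 0) (e 1))).
  apply definable_and; [|exact HP].
  exact (definable_term_shift (definable_term_shift Ht)).
Qed.

Lemma definable_mem (t s : (nat -> U) -> U) :
  definable_term t -> definable_term s -> definable (fun e => t e ∈ s e).
Proof. exact (definable_app2 (definable_mem_var 0 1)). Qed.

Lemma definable_eq (t s : (nat -> U) -> U) :
  definable_term t -> definable_term s -> definable (fun e => t e = s e).
Proof. exact (definable_app2 (definable_eq_var 0 1)). Qed.

Lemma definable_ur (t : (nat -> U) -> U) :
  definable_term t -> definable (fun e => ur (t e)).
Proof. exact (definable_app1 (definable_ur_var 0)). Qed.

Lemma definable_fun1 (f : U -> U) (t : (nat -> U) -> U) :
  definable (fun e => e 0 = f (e 1)) -> definable_term t ->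
  definable_term (fun e => f (t e)).
Proof.
  intros Hf Ht.
  exact (@definable_app2 (fun x y => x = f y) (fun e => e 0) (fun e => t (tail e))
           Hf (definable_var 0) (definable_term_shift Ht)).
Qed.

Lemma definable_fun2 (f : U -> U -> U) (t s : (nat -> U) -> U) :
  definable (fun e => e 0 = f (e 1) (e 2)) -> definable_term t -> definable_term s ->
  definable_term (fun e => f (t e) (s e)).
Proof.
  intros Hf Ht Hs.
  exact (@definable_app3 (fun x y z => x = f y z) (fun e => e 0)
           (fun e => t (tail e)) (fun e => s (tail e))
           Hf (definable_var 0) (definable_term_shift Ht) (definable_term_shift Hs)).
Qed.

End Definability.

(* Proof search for definability *)
Create HintDb definability.
#[local] Hint Constants Opaque : definability.

(** A hypothesis about a term has to be shifted once for each quantifier crossed; successive shifts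
    are tried up to depth [n]. *)
Ltac exact_shift n H :=
  first [ exact H
        | match n with S ?m => exact_shift m constr:(definable_term_shift H) end ].

Ltac definability_step :=
  cbv beta delta [tail];
  match goal with
  | |- definable_term (fun e => e _) => apply definable_var
  | |- definable_term (fun _ => ?c) => apply (definable_const c)
  | H : definable_term ?t |- definable_term (fun e => ?t _) => exact_shift 6 H
  | |- definable (fun e => forall x : carrier _, @?P e x) =>
      apply (@definable_all _ (fun x e => P e x))
  | |- definable (fun e => exists x : carrier _, @?P e x) =>
      apply (@definable_ex _ (fun x e => P e x))
  | |- definable (fun e => _ <-> _) => apply definable_equiv
  | |- definable (fun e => _ /\ _) => apply definable_and
  | |- definable (fun e => _ \/ _) => apply definable_or
  | |- definable (fun e => ~ _) => apply definable_not
  | |- definable (fun e => _ -> _) => apply definable_imp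
  | |- definable (fun e => _ ∈ _) => apply definable_mem
  | |- definable (fun e => _ = _) => apply definable_eq
  | |- definable (fun e => ur _) => apply definable_ur
  | |- definable (fun e => False) => apply definable_bot
  end.

#[local] Hint Extern 1 (definable _) => definability_step : definability.
#[local] Hint Extern 1 (definable_term _) => definability_step : definability.

Ltac definability := eauto 200 with definability nocore.

Lemma definable_is_set (U : structure) (t : (nat -> U) -> U) :
  definable_term t ->
  definable (fun e => is_set (t e)).
Proof. intros; unfold is_set; definability. Qed.
#[local] Hint Resolve definable_is_set : definability.

Lemma definable_subset (U : structure) (t s : (nat -> U) -> U) :
  definable_term t -> definable_term s ->
  definable (fun e => subset (t e) (s e)).
Proof. intros; unfold subset; definability. Qed.
#[local] Hint Resolve definable_subset : definability.

Lemma definable_is_upair (U : structure) (t s r : (nat -> U) -> U) :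
  definable_term t -> definable_term s -> definable_term r ->
  definable (fun e => is_upair (t e) (s e) (r e)).
Proof. intros; unfold is_upair; definability. Qed.
#[local] Hint Resolve definable_is_upair : definability.

Lemma definable_is_opair (U : structure) (t s r : (nat -> U) -> U) :
  definable_term t -> definable_term s -> definable_term r ->
  definable (fun e => is_opair (t e) (s e) (r e)).
Proof. intros; unfold is_opair; definability. Qed.
#[local] Hint Resolve definable_is_opair : definability.

Lemma definable_is_rel (U : structure) (t : (nat -> U) -> U) :
  definable_term t ->
  definable (fun e => is_rel (t e)).
Proof. intros; unfold is_rel; definability. Qed.
#[local] Hint Resolve definable_is_rel : definability.

Lemma definable_maps (U : structure) (t s r : (nat -> U) -> U) :
  definable_term t -> definable_term s -> definable_term r ->
  definable (fun e => maps (t e) (s e) (r e)).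
Proof. intros; unfold maps; definability. Qed.
#[local] Hint Resolve definable_maps : definability.

Lemma definable_is_function (U : structure) (t : (nat -> U) -> U) :
  definable_term t ->
  definable (fun e => is_function (t e)).
Proof. intros; unfold is_function; definability. Qed.
#[local] Hint Resolve definable_is_function : definability.

Lemma definable_is_dom (U : structure) (t s : (nat -> U) -> U) :
  definable_term t -> definable_term s ->
  definable (fun e => is_dom (t e) (s e)).
Proof. intros; unfold is_dom; definability. Qed.
#[local] Hint Resolve definable_is_dom : definability.

Lemma definable_transitive (U : structure) (t : (nat -> U) -> U) :
  definable_term t ->
  definable (fun e => transitive (t e)).
Proof. intros; unfold transitive; definability. Qed.
#[local] Hint Resolve definable_transitive : definability.

Lemma definable_is_ordinal (U : structure) (t : (nat -> U) -> U) :
  definable_term t ->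
  definable (fun e => is_ordinal (t e)).
Proof. intros; unfold is_ordinal; definability. Qed.
#[local] Hint Resolve definable_is_ordinal : definability.

Lemma definable_is_tc (U : structure) (t s : (nat -> U) -> U) :
  definable_term t -> definable_term s ->
  definable (fun e => is_tc (t e) (s e)).
Proof. intros; unfold is_tc; definability. Qed.
#[local] Hint Resolve definable_is_tc : definability.

Lemma definable_in_tc_singleton (U : structure) (t s : (nat -> U) -> U) :
  definable_term t -> definable_term s ->
  definable (fun e => in_tc_singleton (t e) (s e)).
Proof. intros; unfold in_tc_singleton; definability. Qed.
#[local] Hint Resolve definable_in_tc_singleton : definability.

Lemma definable_is_ker (U : structure) (t s : (nat -> U) -> U) :
  definable_term t -> definable_term s ->
  definable (fun e => is_ker (t e) (s e)).
Proof. intros; unfold is_ker; definability. Qed.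
#[local] Hint Resolve definable_is_ker : definability.

Lemma definable_is_action_approx (U : structure) (t s : (nat -> U) -> U) :
  definable_term t -> definable_term s ->
  definable (fun e => is_action_approx (t e) (s e)).
Proof. intros; unfold is_action_approx; definability. Qed.
#[local] Hint Resolve definable_is_action_approx : definability.

Lemma definable_acts (U : structure) (t s r : (nat -> U) -> U) :
  definable_term t -> definable_term s -> definable_term r ->
  definable (fun e => acts (t e) (s e) (r e)).
Proof. intros; unfold acts; definability. Qed.
#[local] Hint Resolve definable_acts : definability.

Lemma definable_in_sym (U : structure) (t s r : (nat -> U) -> U) :
  definable_term t -> definable_term s -> definable_term r ->
  definable (fun e => in_sym (t e) (s e) (r e)).
Proof. intros; unfold in_sym; definability. Qed.
#[local] Hint Resolve definable_in_sym : definability.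

Lemma definable_is_sym (U : structure) (t s r : (nat -> U) -> U) :
  definable_term t -> definable_term s -> definable_term r ->
  definable (fun e => is_sym (t e) (s e) (r e)).
Proof. intros; unfold is_sym; definability. Qed.
#[local] Hint Resolve definable_is_sym : definability.

Lemma definable_symmetric (U : structure) (t s r : (nat -> U) -> U) :
  definable_term t -> definable_term s -> definable_term r ->
  definable (fun e => symmetric (t e) (s e) (r e)).
Proof. intros; unfold symmetric; definability. Qed.
#[local] Hint Resolve definable_symmetric : definability.

Lemma definable_hereditarily_symmetric (U : structure) (t s r : (nat -> U) -> U) :
  definable_term t -> definable_term s -> definable_term r ->
  definable (fun e => hereditarily_symmetric (t e) (s e) (r e)).
Proof. intros; unfold hereditarily_symmetric; definability. Qed.
#[local] Hint Resolve definable_hereditarily_symmetric : definability.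

Lemma definable_in_small_kernel_model (U : structure) (t s r q : (nat -> U) -> U) :
  definable_term t -> definable_term s -> definable_term r -> definable_term q ->
  definable (fun e => in_small_kernel_model (t e) (s e) (r e) (q e)).
Proof. intros; unfold in_small_kernel_model; definability. Qed.
#[local] Hint Resolve definable_in_small_kernel_model : definability.

(* Set theory in an arbitrary structure satisfying ZFU, applied to [U] and once to the model *)
Existing Class ZFU.

Section SetTheory.
Context {U : structure} {HU : ZFU U}.
Implicit Types x y z w f A π σ ρ i ι : U.

Lemma zfu_inhabited : inhabited U.
Proof. destruct (zfu_infinity HU) as [x _]; exact (inhabits x). Qed.

(** Choice in the metatheory serves only to name objects. Definability is claimed just for
    descriptions with exactly one solution, so no choice principle enters [U]. *)
Definition the (P : U -> Prop) : U := epsilon zfu_inhabited P.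

Definition small (P : U -> Prop) : Prop :=
  exists y, is_set y /\ forall z, z ∈ y <-> P z.

Definition setof (P : U -> Prop) : U :=
  the (fun y => is_set y /\ forall z, z ∈ y <-> P z).

Lemma setof_spec (P : U -> Prop) :
  small P -> is_set (setof P) /\ forall z, z ∈ setof P <-> P z.
Proof. intros H; unfold setof, the; apply epsilon_spec; exact H. Qed.

Lemma set_ext x y : is_set x -> is_set y -> (forall z, z ∈ x <-> z ∈ y) -> x = y.
Proof. apply zfu_extensionality; exact HU. Qed.

Lemma mem_is_set x y : x ∈ y -> is_set y.
Proof. intros H Hu; exact (zfu_urelements HU Hu H). Qed.

Lemma small_separation (P : U -> Prop) x :
  definable (fun e => P (e 0)) -> small (fun z => z ∈ x /\ P z).
Proof.
  intros HP; destruct (HP x) as (q & c & Hq).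
  (* As [P] reads [e 0] alone, every even variable may be sent to 0; the parameters occupy the
     remaining indices. *)
  destruct (zfu_separation HU (ren (fun k => if Nat.even k then 0 else S (Nat.div2 k)) q) c x)
    as (y & Hy & H).
  exists y; split; [exact Hy|]. intros z; rewrite H.
  rewrite (Hq (fun _ => z)), sat_ren.
  apply and_iff_compat_l, sat_ext. intros k; unfold join; destruct (Nat.even k); reflexivity.
Qed.

Lemma small_iff (P Q : U -> Prop) : (forall z, P z <-> Q z) -> small Q -> small P.
Proof. intros H (y & Hy & Hy'); exists y; split; [exact Hy|]; firstorder. Qed.

Lemma small_replacement (R : U -> U -> Prop) x :
  definable (fun e => R (e 0) (e 1)) ->
  (forall z, z ∈ x -> exists! w, R w z) ->
  small (fun w => exists z, z ∈ x /\ R w z).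
Proof.
  intros HR Hx; destruct (HR x) as (q & c & Hq).
  set (r := fun k => if Nat.even k then match Nat.div2 k with 0 => 0 | _ => 1 end
                     else S (S (Nat.div2 k))).
  assert (E : forall w z, R w z <-> sat (scons w (scons z c)) (ren r q)).
  { intros w z. rewrite (Hq (fun n => match n with 0 => w | _ => z end)), sat_ren.
    apply sat_ext; intros k; unfold join, r.
    destruct (Nat.even k); [destruct (Nat.div2 k)|]; reflexivity. }
  destruct (@zfu_replacement U HU (ren r q) c x) as (y & Hy & H).
  { intros z Hz; destruct (Hx z Hz) as (w & Hw & Hu); exists w; split.
    - apply E; exact Hw.
    - intros w' Hw'; apply Hu, E; exact Hw'. }
  exists y; split; [exact Hy|]. intros w; rewrite H.
  split; intros (z & Hz & Hw); exists z; (split; [exact Hz|]); apply E; exact Hw.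
Qed.

(** Extensionality turns an equation with [setof] into a formula. Smallness is asked for in every
    context because [setof] is arbitrary on a proper class. *)
Lemma definable_setof (P : (nat -> U) -> U -> Prop) :
  (forall e, small (P e)) -> definable (fun e => P (tail e) (e 0)) ->
  definable_term (fun e => setof (P e)).
Proof.
  intros HS HP.
  apply (@definable_iff _ _ (fun e => is_set (e 0) /\ forall z, z ∈ e 0 <-> P (tail e) z)).
  - intros e; destruct (setof_spec (HS (tail e))) as [H1 H2]. split.
    + intros ->; split; assumption.
    + intros [H3 H4]; apply set_ext; [exact H3|exact H1|].
      intros z; rewrite H4, H2; reflexivity.
  - apply definable_and; [definability|].
    apply (@definable_all _ (fun z e => z ∈ e 0 <-> P (tail e) z)).
    apply definable_equiv; [definability|].
    exact (@definable_subst _ _ (fun n => match n with 0 => inl 0 | S k => inl (S (S k)) end) HP).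
Qed.

(** ** Elementary sets *)

Definition emp : U := setof (fun _ => False).
Definition upair x y : U := setof (fun z => z = x \/ z = y).
Definition sing x : U := upair x x.
Definition Union x : U := setof (fun z => exists y, y ∈ x /\ z ∈ y).
Definition cup x y : U := setof (fun z => z ∈ x \/ z ∈ y).
Definition pow x : U := setof (fun z => is_set z /\ z ⊆ x).
Definition opair x y : U := upair (sing x) (upair x y).
Definition succ x : U := cup x (sing x).
Definition sep x (P : U -> Prop) : U := setof (fun z => z ∈ x /\ P z).
Definition img (F : U -> U) x : U := setof (fun w => exists z, z ∈ x /\ w = F z).
Definition prod x y : U :=
  setof (fun p => exists a b, a ∈ x /\ b ∈ y /\ p = opair a b).

Lemma small_sub_set (P : U -> Prop) x :
  definable (fun e => P (e 0)) -> (forall z, P z -> z ∈ x) -> small P.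
Proof.
  intros HP H; apply (@small_iff _ (fun z => z ∈ x /\ P z)); [firstorder|].
  apply small_separation; exact HP.
Qed.

Lemma small_emp : small (fun _ => False).
Proof.
  destruct zfu_inhabited as [u].
  apply (@small_sub_set _ u); [definability|tauto].
Qed.

Lemma small_upair x y : small (fun z => z = x \/ z = y).
Proof. exact (zfu_pairing HU x y). Qed.

Lemma small_Union x : small (fun z => exists y, y ∈ x /\ z ∈ y).
Proof. exact (zfu_union HU x). Qed.

Lemma in_emp z : z ∈ emp <-> False.
Proof. apply (setof_spec small_emp). Qed.

Lemma in_upair x y z : z ∈ upair x y <-> z = x \/ z = y.
Proof. apply (setof_spec (small_upair x y)). Qed.

Lemma in_sing x z : z ∈ sing x <-> z = x.
Proof. unfold sing; rewrite in_upair; tauto. Qed.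

Lemma in_Union x z : z ∈ Union x <-> exists y, y ∈ x /\ z ∈ y.
Proof. apply (setof_spec (small_Union x)). Qed.

Lemma small_cup x y : small (fun z => z ∈ x \/ z ∈ y).
Proof.
  apply (@small_iff _ (fun z => exists v, v ∈ upair x y /\ z ∈ v)); [|apply small_Union].
  intros z; split.
  - intros [H|H]; [exists x|exists y]; rewrite in_upair; auto.
  - intros (v & Hv & Hz); apply in_upair in Hv; destruct Hv as [->| ->]; auto.
Qed.

Lemma in_cup x y z : z ∈ cup x y <-> z ∈ x \/ z ∈ y.
Proof. apply (setof_spec (small_cup x y)). Qed.

Lemma is_set_emp : is_set emp.
Proof. exact (proj1 (setof_spec small_emp)). Qed.
Lemma is_set_upair x y : is_set (upair x y).
Proof. exact (proj1 (setof_spec (small_upair x y))). Qed.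
Lemma is_set_Union x : is_set (Union x).
Proof. exact (proj1 (setof_spec (small_Union x))). Qed.
Lemma is_set_cup x y : is_set (cup x y).
Proof. exact (proj1 (setof_spec (small_cup x y))). Qed.
Lemma is_set_opair x y : is_set (opair x y).
Proof. apply is_set_upair. Qed.
Lemma is_set_succ x : is_set (succ x).
Proof. apply is_set_cup. Qed.

Lemma in_succ x z : z ∈ succ x <-> z ∈ x \/ z = x.
Proof. unfold succ; rewrite in_cup, in_sing; reflexivity. Qed.

Lemma is_empty_emp x : is_empty x <-> x = emp.
Proof.
  split.
  - intros [H1 H2]; apply set_ext; [exact H1|apply is_set_emp|].
    intros z; rewrite in_emp; firstorder.
  - intros ->; split; [apply is_set_emp|]; intros z; rewrite in_emp; tauto.
Qed.

Lemma small_pow x : small (fun z => is_set z /\ z ⊆ x).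
Proof.
  destruct (classic (is_set x)) as [Hx|Hx]; [exact (zfu_powerset HU Hx)|].
  (* The Powerset axiom speaks of sets only; if [x] is an urelement, the empty set is its one
     subset. *)
  apply (@small_sub_set _ (sing emp)); [definability|].
  intros z [Hz H]; rewrite in_sing; apply is_empty_emp; split; [exact Hz|].
  intros w Hw; apply Hx; exact (mem_is_set (H w Hw)).
Qed.

Lemma in_pow x z : z ∈ pow x <-> is_set z /\ z ⊆ x.
Proof. apply (setof_spec (small_pow x)). Qed.

Lemma in_sep x P z : definable (fun e => P (e 0)) -> z ∈ sep x P <-> z ∈ x /\ P z.
Proof. intros H; apply (setof_spec (small_separation x H)). Qed.
Lemma is_set_sep x P : definable (fun e => P (e 0)) -> is_set (sep x P).
Proof. intros H; exact (proj1 (setof_spec (small_separation x H))). Qed.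

Lemma small_img F x : definable (fun e => e 0 = F (e 1)) ->
  small (fun w => exists z, z ∈ x /\ w = F z).
Proof.
  intros H; apply (@small_replacement (fun w z => w = F z)); [exact H|].
  intros z _; exists (F z); split; [reflexivity|]; intros w E; symmetry; exact E.
Qed.

Lemma in_img F x w : definable (fun e => e 0 = F (e 1)) ->
  w ∈ img F x <-> exists z, z ∈ x /\ w = F z.
Proof. intros H; apply (setof_spec (small_img x H)). Qed.
Lemma is_set_img F x : definable (fun e => e 0 = F (e 1)) -> is_set (img F x).
Proof. intros H; exact (proj1 (setof_spec (small_img x H))). Qed.

Section DefinableTerms.
Implicit Types t s : (nat -> U) -> U.

Lemma definable_upair t s : definable_term t -> definable_term s ->
  definable_term (fun e => upair (t e) (s e)).
Proof.
  intros; apply (@definable_setof (fun e z => z = t e \/ z = s e)).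
  - intros e; apply small_upair.
  - definability.
Qed.

Lemma definable_sing t : definable_term t -> definable_term (fun e => sing (t e)).
Proof. intros; apply definable_upair; assumption. Qed.

Lemma definable_opair t s : definable_term t -> definable_term s ->
  definable_term (fun e => opair (t e) (s e)).
Proof.
  intros; apply definable_upair; [apply definable_sing|apply definable_upair]; assumption.
Qed.

Lemma definable_Union t : definable_term t -> definable_term (fun e => Union (t e)).
Proof.
  intros; apply (@definable_setof (fun e z => exists y, y ∈ t e /\ z ∈ y)).
  - intros e; apply small_Union.
  - definability.
Qed.

Lemma definable_cup t s : definable_term t -> definable_term s ->
  definable_term (fun e => cup (t e) (s e)).
Proof.
  intros; apply (@definable_setof (fun e z => z ∈ t e \/ z ∈ s e)).
  - intros e; apply small_cup.
  - definability.
Qed.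

Lemma definable_succ t : definable_term t -> definable_term (fun e => succ (t e)).
Proof. intros; apply definable_cup; [|apply definable_sing]; assumption. Qed.

Lemma definable_pow t : definable_term t -> definable_term (fun e => pow (t e)).
Proof.
  intros; apply (@definable_setof (fun e z => is_set z /\ z ⊆ t e)).
  - intros e; apply small_pow.
  - definability.
Qed.

Lemma definable_img F t :
  definable (fun e => e 0 = F (e 1)) ->
  definable_term t -> definable_term (fun e => img F (t e)).
Proof.
  intros HF Ht; apply (@definable_setof (fun e w => exists z, z ∈ t e /\ w = F z)).
  - intros e; apply small_img; exact HF.
  - apply (@definable_ex _ (fun z e => z ∈ t (tail e) /\ e 0 = F z)).
    apply definable_and; [definability|].
    apply (@definable_app2 _ (fun a b => a = F b)); [exact HF| |]; definability.
Qed.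

End DefinableTerms.

Hint Resolve definable_upair definable_sing definable_opair definable_Union
  definable_cup definable_succ definable_pow : definability.

(** ** Ordered pairs and functions *)

Lemma upair_inj x y x' y' :
  upair x y = upair x' y' -> (x = x' /\ y = y') \/ (x = y' /\ y = x').
Proof.
  intros H.
  assert (E : forall z, (z = x \/ z = y) <-> (z = x' \/ z = y')).
  { intros z; rewrite <- !in_upair, H; reflexivity. }
  pose proof (proj1 (E x) (or_introl eq_refl)).
  pose proof (proj1 (E y) (or_intror eq_refl)).
  pose proof (proj2 (E x') (or_introl eq_refl)).
  pose proof (proj2 (E y') (or_intror eq_refl)).
  intuition congruence.
Qed.

Lemma opair_inj x y x' y' : opair x y = opair x' y' -> x = x' /\ y = y'.
Proof.
  intros H; apply upair_inj in H; unfold sing in H.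
  destruct H as [[H1 H2]|[H1 H2]]; apply upair_inj in H1; apply upair_inj in H2;
    intuition congruence.
Qed.

Lemma is_upair_iff p x y : is_upair p x y <-> p = upair x y.
Proof.
  split.
  - intros [H1 H2]; apply set_ext; [exact H1|apply is_set_upair|].
    intros z; rewrite H2, in_upair; reflexivity.
  - intros ->; split; [apply is_set_upair|]; intros w; apply in_upair.
Qed.

Lemma is_opair_iff p x y : is_opair p x y <-> p = opair x y.
Proof.
  split.
  - intros (s & t & H1 & H2 & H3).
    rewrite is_upair_iff in *; subst; reflexivity.
  - intros ->; exists (sing x), (upair x y); rewrite !is_upair_iff; repeat split.
Qed.

Lemma maps_iff f x y : maps f x y <-> opair x y ∈ f.
Proof.
  split.
  - intros (p & H & Hp); apply is_opair_iff in Hp; subst; exact H.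
  - intros H; exists (opair x y); split; [exact H|apply is_opair_iff; reflexivity].
Qed.

Lemma is_succ_iff y x : is_succ y x <-> y = succ x.
Proof.
  split.
  - intros [H1 H2]; apply set_ext; [exact H1|apply is_set_succ|].
    intros z; rewrite H2, in_succ; reflexivity.
  - intros ->; split; [apply is_set_succ|]; intros w; apply in_succ.
Qed.

Lemma small_prod x y : small (fun p => exists a b, a ∈ x /\ b ∈ y /\ p = opair a b).
Proof.
  apply (@small_sub_set _ (pow (pow (cup x y)))); [definability|].
  intros p (a & b & Ha & Hb & ->). apply in_pow; split; [apply is_set_opair|].
  intros z Hz. apply in_upair in Hz; apply in_pow.
  destruct Hz as [->| ->]; split; try apply is_set_upair; intros w Hw.
  - apply in_sing in Hw; subst; apply in_cup; auto.
  - apply in_upair in Hw; destruct Hw; subst; apply in_cup; auto.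
Qed.

Lemma in_prod x y p : p ∈ prod x y <-> exists a b, a ∈ x /\ b ∈ y /\ p = opair a b.
Proof. apply (setof_spec (small_prod x y)). Qed.
Lemma is_set_prod x y : is_set (prod x y).
Proof. exact (proj1 (setof_spec (small_prod x y))). Qed.

Lemma opair_in_prod a b x y : opair a b ∈ prod x y <-> a ∈ x /\ b ∈ y.
Proof.
  rewrite in_prod; split.
  - intros (a' & b' & Ha & Hb & E); apply opair_inj in E; destruct E; subst; auto.
  - intros [Ha Hb]; eauto 6.
Qed.

(** ** Foundation and the natural numbers *)

Lemma mem_irrefl x : ~ x ∈ x.
Proof.
  intros H. destruct (@zfu_foundation U HU (sing x)) as (y & Hy & N).
  - exists x; apply in_sing; reflexivity.
  - apply in_sing in Hy; subst y; apply N; exists x; split; [apply in_sing|]; auto.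
Qed.

Lemma mem_asym x y : x ∈ y -> ~ y ∈ x.
Proof.
  intros H1 H2. destruct (@zfu_foundation U HU (upair x y)) as (z & Hz & N).
  - exists x; apply in_upair; auto.
  - apply N. apply in_upair in Hz; destruct Hz as [->| ->];
      [exists y|exists x]; rewrite in_upair; auto.
Qed.

Lemma succ_inj x y : succ x = succ y -> x = y.
Proof.
  intros H.
  assert (Hx : x ∈ succ y) by (rewrite <- H; apply in_succ; auto).
  assert (Hy : y ∈ succ x) by (rewrite H; apply in_succ; auto).
  apply in_succ in Hx, Hy. destruct Hx as [Hx|]; [|assumption].
  destruct Hy as [Hy|]; [|congruence]. destruct (mem_asym Hx Hy).
Qed.

Lemma succ_neq_emp x : succ x <> emp.
Proof. intros H; apply (in_emp x); rewrite <- H; apply in_succ; auto. Qed.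

Definition inductive y : Prop := emp ∈ y /\ forall n, n ∈ y -> succ n ∈ y.

Definition omega : U := setof (fun n => forall y, inductive y -> n ∈ y).

Lemma small_omega : small (fun n => forall y, inductive y -> n ∈ y).
Proof.
  destruct (zfu_infinity HU) as (X & HX & (z & Hz & HzX) & H).
  apply (@small_sub_set _ X).
  - unfold inductive; definability.
  - intros n Hn; apply Hn; split.
    + apply is_empty_emp in Hz; subst; exact HzX.
    + intros m Hm; destruct (H m Hm) as (s & Hs & Hs').
      apply is_succ_iff in Hs; subst; exact Hs'.
Qed.

Lemma in_omega n : n ∈ omega <-> forall y, inductive y -> n ∈ y.
Proof. apply (setof_spec small_omega). Qed.

Lemma emp_in_omega : emp ∈ omega.
Proof. apply in_omega; intros y [H _]; exact H. Qed.

Lemma succ_in_omega n : n ∈ omega -> succ n ∈ omega.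
Proof.
  rewrite !in_omega; intros H y Hy; apply Hy, H; exact Hy.
Qed.

Lemma omega_ind (P : U -> Prop) :
  definable (fun e => P (e 0)) ->
  P emp -> (forall n, n ∈ omega -> P n -> P (succ n)) ->
  forall n, n ∈ omega -> P n.
Proof.
  intros HP H0 HS n Hn.
  cut (n ∈ sep omega P); [rewrite in_sep by exact HP; tauto|].
  apply (proj1 (in_omega n) Hn); split.
  - rewrite in_sep by exact HP; split; [apply emp_in_omega|exact H0].
  - intros m; rewrite !in_sep by exact HP; intros [H1 H2]; split.
    + apply succ_in_omega; exact H1.
    + apply HS; assumption.
Qed.

(** ** Transitive closures and ∈-induction *)

(* A graph whose entries are justified by smaller entries need not be a function,
   and so is closed under adding a new justified entry. *)
Definition iter_approx x f : Prop :=
  forall k w, opair k w ∈ f ->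
    (k = emp /\ w = x) \/
    exists j u, k = succ j /\ w = Union u /\ opair j u ∈ f.

Definition iterates x n w : Prop := exists f, iter_approx x f /\ opair n w ∈ f.

Lemma definable_iterates t s r :
  definable_term t -> definable_term s -> definable_term r ->
  definable (fun e => iterates (t e) (s e) (r e)).
Proof. intros; unfold iterates, iter_approx; definability. Qed.
Hint Resolve definable_iterates : definability.

Lemma iterates_emp x : iterates x emp x.
Proof.
  exists (sing (opair emp x)); split; [|apply in_sing; reflexivity].
  intros k w H; apply in_sing, opair_inj in H; tauto.
Qed.

Lemma iterates_succ x n w : iterates x n w -> iterates x (succ n) (Union w).
Proof.
  intros (f & Hf & Hn). exists (cup f (sing (opair (succ n) (Union w)))); split.
  - intros k v H; apply in_cup in H; destruct H as [H|H].
    + destruct (Hf k v H) as [|(j & u & E1 & E2 & Hj)]; [tauto|].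
      right; exists j, u; rewrite in_cup; auto.
    + apply in_sing, opair_inj in H; right; exists n, w; rewrite in_cup; tauto.
  - apply in_cup; right; apply in_sing; reflexivity.
Qed.

Lemma iterates_inv x n w :
  iterates x n w -> (n = emp /\ w = x) \/
  exists j u, n = succ j /\ w = Union u /\ iterates x j u.
Proof.
  intros (f & Hf & Hn); destruct (Hf n w Hn) as [|(j & u & E1 & E2 & Hj)]; [tauto|].
  right; exists j, u; repeat split; try assumption; exists f; auto.
Qed.

Lemma iterates_exists_unique x n : n ∈ omega -> exists! w, iterates x n w.
Proof.
  intros Hn.
  assert (E : exists w, iterates x n w).
  { revert n Hn; apply (@omega_ind (fun n => exists w, iterates x n w)); [definability| |].
    - exists x; apply iterates_emp.
    - intros n _ (w & Hw); exists (Union w); apply iterates_succ; exact Hw. }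
  destruct E as (w & Hw); exists w; split; [exact Hw|].
  revert w Hw; pattern n; revert n Hn; apply omega_ind.
  - definability.
  - intros w H w' H'. apply iterates_inv in H, H'.
    destruct H as [[_ ->]|(j & u & E & _)]; [|destruct (@succ_neq_emp j); auto].
    destruct H' as [[_ ->]|(j & u & E & _)]; [auto|destruct (@succ_neq_emp j); auto].
  - intros n Hn IH w H w' H'. apply iterates_inv in H, H'.
    destruct H as [[E _]|(j & u & E & -> & Hj)]; [destruct (succ_neq_emp E)|].
    destruct H' as [[E' _]|(j' & u' & E' & -> & Hj')]; [destruct (succ_neq_emp E')|].
    apply succ_inj in E, E'; subst j j'. f_equal; apply IH; assumption.
Qed.

Definition tcl x : U := setof (fun y => exists n w, n ∈ omega /\ iterates x n w /\ y ∈ w).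

Lemma small_tcl x : small (fun y => exists n w, n ∈ omega /\ iterates x n w /\ y ∈ w).
Proof.
  destruct (@small_replacement (fun w n => iterates x n w) omega) as (W & HW & HW').
  - definability.
  - apply iterates_exists_unique.
  - apply (@small_iff _ (fun y => exists w, w ∈ W /\ y ∈ w)); [|apply small_Union].
    intros y; split.
    + intros (n & w & H1 & H2 & H3); exists w; split; [|exact H3]; apply HW'; eauto.
    + intros (w & H & H3); apply HW' in H; destruct H as (n & H1 & H2); eauto 6.
Qed.

Lemma in_tcl x y : y ∈ tcl x <-> exists n w, n ∈ omega /\ iterates x n w /\ y ∈ w.
Proof. apply (setof_spec (small_tcl x)). Qed.

Lemma is_tc_tcl x : is_tc (tcl x) x.
Proof.
  pose proof (setof_spec (small_tcl x)) as [Hset H]. repeat split.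
  - exact Hset.
  - intros y Hy z Hz; apply in_tcl in Hy; apply in_tcl.
    destruct Hy as (n & w & Hn & Hw & Hy); exists (succ n), (Union w); repeat split.
    + apply succ_in_omega; exact Hn.
    + apply iterates_succ; exact Hw.
    + apply in_Union; eauto.
  - intros y Hy; apply in_tcl; exists emp, x; auto using emp_in_omega, iterates_emp.
  - intros s [_ Hs] Hx y Hy; apply in_tcl in Hy; destruct Hy as (n & w & Hn & Hw & Hy).
    revert w Hw y Hy; pattern n; revert n Hn; apply omega_ind.
    + definability.
    + intros w Hw; apply iterates_inv in Hw.
      destruct Hw as [[_ ->]|(j & u & E & _)]; [exact Hx|destruct (@succ_neq_emp j); auto].
    + intros n Hn IH w Hw y Hy; apply iterates_inv in Hw.
      destruct Hw as [[E _]|(j & u & E & -> & Hj)]; [destruct (succ_neq_emp E)|].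
      apply succ_inj in E; subst j. apply in_Union in Hy; destruct Hy as (v & Hv & Hy).
      exact (Hs v (IH u Hj v Hv) y Hy).
Qed.

Definition TC x : U := tcl (sing x).

Lemma is_tc_unique x s t : is_tc s x -> is_tc t x -> s = t.
Proof.
  intros (H1 & H2 & H3) (H4 & H5 & H6); apply set_ext; [apply H1|apply H4|].
  intros z; split; [apply H3|apply H6]; assumption.
Qed.

Lemma in_tc_singleton_iff y x : in_tc_singleton y x <-> y ∈ TC x.
Proof.
  unfold in_tc_singleton, TC; split.
  - intros (s & t & Hs & Ht & Hy). apply is_upair_iff in Hs; subst s.
    rewrite (is_tc_unique (is_tc_tcl (sing x)) Ht); exact Hy.
  - intros H; exists (sing x), (tcl (sing x)).
    split; [apply is_upair_iff; reflexivity|]. split; [apply is_tc_tcl|exact H].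
Qed.

Lemma is_set_TC x : is_set (TC x).
Proof. exact (proj1 (proj1 (is_tc_tcl (sing x)))). Qed.

Lemma TC_self x : x ∈ TC x.
Proof. apply (proj1 (proj2 (is_tc_tcl (sing x)))), in_sing; reflexivity. Qed.

Lemma TC_trans x y z : y ∈ TC x -> z ∈ y -> z ∈ TC x.
Proof. intros Hy Hz; exact (proj2 (proj1 (is_tc_tcl (sing x))) y Hy z Hz). Qed.

Lemma TC_min x s : transitive s -> x ∈ s -> TC x ⊆ s.
Proof.
  intros Hs Hx; apply (proj2 (proj2 (is_tc_tcl (sing x)))); [exact Hs|].
  intros z Hz; apply in_sing in Hz; subst; exact Hx.
Qed.

Lemma definable_TC t : definable_term t -> definable_term (fun e => TC (t e)).
Proof.
  intros; unfold TC.
  apply (@definable_setof (fun e y => exists n w, n ∈ omega /\ iterates (sing (t e)) n w /\ y ∈ w)).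
  - intros e; apply small_tcl.
  - definability.
Qed.
Hint Resolve definable_TC : definability.

(** Foundation provides minimal elements of sets, not of classes; one counterexample [x] confines
    the search to the set [TC x]. *)
Lemma mem_induction (P : U -> Prop) :
  definable (fun e => P (e 0)) ->
  (forall x, (forall y, y ∈ x -> P y) -> P x) -> forall x, P x.
Proof.
  intros HP IH x; apply NNPP; intros N.
  assert (HN : definable (fun e => ~ P (e 0))) by (apply definable_not; exact HP).
  destruct (@zfu_foundation U HU (sep (TC x) (fun z => ~ P z))) as (y & Hy & Hmin).
  { exists x; rewrite in_sep by exact HN; split; [apply TC_self|exact N]. }
  rewrite in_sep in Hy by exact HN; destruct Hy as [Hy Ny].
  apply Ny, IH; intros z Hz; apply NNPP; intros Nz; apply Hmin.
  exists z; rewrite in_sep by exact HN; repeat split; auto. exact (TC_trans Hy Hz).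
Qed.

Lemma TC_subset x y : y ∈ TC x -> TC y ⊆ TC x.
Proof.
  intros H; apply TC_min; [|exact H]. split; [apply is_set_TC|].
  intros z Hz w Hw; exact (TC_trans Hz Hw).
Qed.

Lemma in_TC_iff x z : z ∈ TC x <-> z = x \/ exists y, y ∈ x /\ z ∈ TC y.
Proof.
  split.
  - revert z.
    assert (D : definable (fun e => e 0 = x \/ exists y, y ∈ x /\ e 0 ∈ TC y)) by definability.
    assert (S : forall z, z ∈ sep (TC x) (fun z => z = x \/ exists y, y ∈ x /\ z ∈ TC y) <->
        z ∈ TC x /\ (z = x \/ exists y, y ∈ x /\ z ∈ TC y)).
    { intros z; apply in_sep; exact D. }
    intros z Hz; apply S; revert z Hz; apply TC_min.
    + split; [apply is_set_sep; exact D|].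
      intros y Hy z Hz; apply S in Hy; apply S; destruct Hy as [H1 H2]; split.
      * exact (TC_trans H1 Hz).
      * right; destruct H2 as [->|(w & Hw & H2)].
        -- exists z; split; [exact Hz|apply TC_self].
        -- exists w; split; [exact Hw|exact (TC_trans H2 Hz)].
    + apply S; split; [apply TC_self|auto].
  - intros [->|(y & Hy & Hz)]; [apply TC_self|].
    exact (TC_subset (TC_trans (TC_self x) Hy) Hz).
Qed.

Lemma TC_induction (P : U -> Prop) x :
  P x -> (forall y z, P y -> z ∈ y -> P z) -> definable (fun e => P (e 0)) ->
  forall y, y ∈ TC x -> P y.
Proof.
  intros Hx Hs HP.
  assert (T : TC x ⊆ sep (TC x) P).
  { apply TC_min.
    - split; [apply is_set_sep; exact HP|].
      intros y Hy z Hz; rewrite in_sep in * by exact HP; destruct Hy as [H1 H2].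
      split; [exact (TC_trans H1 Hz)|exact (Hs y z H2 Hz)].
    - rewrite in_sep by exact HP; auto using TC_self. }
  intros y Hy; apply T in Hy; rewrite in_sep in Hy by exact HP; tauto.
Qed.

(** ** ∈-recursion *)

Section Recursion.
Variable Phi : U -> U -> U.
Hypothesis HPhi : definable (fun e => e 0 = Phi (e 1) (e 2)).

Definition is_image f y v : Prop :=
  is_set v /\ forall w, w ∈ v <-> exists z, z ∈ y /\ opair z w ∈ f.

Definition rec_approx f : Prop :=
  forall y w, opair y w ∈ f ->
    (forall z, z ∈ y -> exists u, opair z u ∈ f) /\
    exists v, is_image f y v /\ w = Phi y v.

Definition rec_graph y w : Prop := exists f, rec_approx f /\ opair y w ∈ f.

Lemma definable_Phi t s :
  definable_term t -> definable_term s -> definable_term (fun e => Phi (t e) (s e)).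
Proof. apply definable_fun2; exact HPhi. Qed.
Hint Resolve definable_Phi : definability.

Lemma definable_rec_graph t s :
  definable_term t -> definable_term s -> definable (fun e => rec_graph (t e) (s e)).
Proof. intros; unfold rec_graph, rec_approx, is_image; definability. Qed.
Hint Resolve definable_rec_graph : definability.

Lemma rec_graph_unique y : forall w w', rec_graph y w -> rec_graph y w' -> w = w'.
Proof.
  pattern y; revert y; apply mem_induction; [definability|].
  intros y IH w w' (f & Hf & Hw) (g & Hg & Hw').
  destruct (Hf y w Hw) as (Tf & v & [Hv Hv'] & ->).
  destruct (Hg y w' Hw') as (Tg & v' & [Kv Kv'] & ->).
  f_equal; apply set_ext; [exact Hv|exact Kv|].
  intros u; rewrite Hv', Kv'; split; intros (z & Hz & Hu); exists z; split; auto.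
  - destruct (Tg z Hz) as (u' & Hu'). rewrite (IH z Hz u u'); auto; [exists f|exists g]; auto.
  - destruct (Tf z Hz) as (u' & Hu'). rewrite (IH z Hz u u'); auto; [exists g|exists f]; auto.
Qed.

Lemma rec_graph_inv y w : rec_graph y w ->
  (forall z, z ∈ y -> exists u, rec_graph z u) /\
  exists v, is_set v /\ (forall u, u ∈ v <-> exists z, z ∈ y /\ rec_graph z u) /\ w = Phi y v.
Proof.
  intros (f & Hf & Hw); destruct (Hf y w Hw) as (T & v & [Hv Hv'] & E).
  split; [intros z Hz; destruct (T z Hz) as (u & Hu); exists u, f; auto|].
  exists v; repeat split; auto.
  - rewrite Hv'; intros (z & Hz & Hu); exists z; split; [exact Hz|exists f; auto].
  - intros (z & Hz & Hu); apply Hv'; exists z; split; [exact Hz|].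
    destruct (T z Hz) as (u' & Hu'). rewrite (@rec_graph_unique z u u'); auto; exists f; auto.
Qed.

Lemma rec_graph_total y : exists w, rec_graph y w.
Proof.
  pattern y; revert y; apply mem_induction; [definability|]. intros y IH.
  (* Assuming that [y] has no value yet guarantees that [g], the graph on those members of [TC y]
     that have a value, contains no entry for [y]; adding one then leaves all images of [g]
     unchanged. *)
  apply NNPP; intros N.
  assert (DT : definable (fun e => exists w, rec_graph (e 0) w)) by definability.
  destruct (@small_replacement (fun p z => exists w, p = opair z w /\ rec_graph z w)
              (sep (TC y) (fun z => exists w, rec_graph z w))) as (g & Hg & Hg').
  { definability. }
  { intros z Hz; rewrite in_sep in Hz by exact DT; destruct Hz as (_ & w & Hw).
    exists (opair z w); split; [eauto|]. intros p (w' & -> & Hw').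
    rewrite (rec_graph_unique Hw Hw'); reflexivity. }
  assert (Gr : forall z w, opair z w ∈ g <-> z ∈ TC y /\ rec_graph z w).
  { intros z w; rewrite Hg'; split.
    - intros (z' & Hz & w' & E & Hw); apply opair_inj in E; destruct E; subst.
      rewrite in_sep in Hz by exact DT; tauto.
    - intros [Hz Hw]; exists z; rewrite in_sep by exact DT; split; [split|]; eauto. }
  assert (Sv : small (fun w => exists z, z ∈ y /\ rec_graph z w)).
  { apply (@small_replacement (fun w z => rec_graph z w)); [definability|].
    intros z Hz; destruct (IH z Hz) as (w & Hw); exists w; split; [exact Hw|].
    intros w'; apply rec_graph_unique; exact Hw. }
  destruct Sv as (v & Hv & Hv').
  assert (Ty : forall z, z ∈ y -> z ∈ TC y) by (intros z; apply TC_trans, TC_self).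
  apply N; exists (Phi y v), (cup g (sing (opair y (Phi y v)))); split.
  2: { apply in_cup; right; apply in_sing; reflexivity. }
  assert (Gh : forall z w, z ∈ TC y -> (exists u, rec_graph z u) ->
            opair z w ∈ cup g (sing (opair y (Phi y v))) <-> rec_graph z w).
  { intros z w Hz Ez; rewrite in_cup, in_sing, Gr; split; [|tauto].
    intros [|E]; [tauto|]; apply opair_inj in E; destruct E as [E _]; subst z; destruct (N Ez). }
  intros z w Hzw; apply in_cup in Hzw; destruct Hzw as [Hzw|Hzw].
  - apply Gr in Hzw; destruct Hzw as [Hz Hw].
    destruct (rec_graph_inv Hw) as (T & v' & H1 & H2 & H3). split.
    + intros a Ha; destruct (T a Ha) as (u & Hu); exists u; apply Gh; auto.
      exact (TC_trans Hz Ha).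
    + exists v'; repeat split; auto; rewrite H2; intros (a & Ha & Hu); exists a;
        (split; [exact Ha|]); apply (Gh a) in Hu || apply Gh; auto; exact (TC_trans Hz Ha).
  - apply in_sing, opair_inj in Hzw; destruct Hzw; subst z w. split.
    + intros z Hz; destruct (IH z Hz) as (u & Hu); exists u; apply Gh; auto.
    + exists v; repeat split; auto; rewrite Hv'; intros (z & Hz & Hu); exists z;
        (split; [exact Hz|]); apply (Gh z) in Hu || apply Gh; auto.
Qed.

Definition rec y : U := the (fun w => rec_graph y w).

Lemma rec_graph_iff y w : rec_graph y w <-> w = rec y.
Proof.
  assert (H : rec_graph y (rec y)).
  { unfold rec, the; apply epsilon_spec, rec_graph_total. }
  split; [intros H'; exact (rec_graph_unique H' H)|intros ->; exact H].
Qed.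

Lemma definable_rec_eq : definable (fun e => e 0 = rec (e 1)).
Proof.
  apply (@definable_iff _ _ (fun e => rec_graph (e 1) (e 0))).
  - intros e; symmetry; apply rec_graph_iff.
  - definability.
Qed.

Lemma definable_rec t : definable_term t -> definable_term (fun e => rec (t e)).
Proof. apply definable_fun1, definable_rec_eq. Qed.

Lemma rec_eq y : rec y = Phi y (img rec y).
Proof.
  destruct (rec_graph_inv (proj2 (rec_graph_iff y _) eq_refl)) as (_ & v & H1 & H2 & E).
  rewrite E; f_equal; apply set_ext; [exact H1|apply is_set_img, definable_rec_eq|].
  intros u; rewrite H2, in_img by exact definable_rec_eq.
  split; intros (z & Hz & Hu); exists z; (split; [exact Hz|]); apply rec_graph_iff; exact Hu.
Qed.

End Recursion.

(** ** Kernels *)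

Definition ker x : U := sep (TC x) (fun a => ur a).

Lemma definable_ker_pred : definable (fun e : nat -> U => ur (e 0)).
Proof. definability. Qed.

Lemma in_ker a x : a ∈ ker x <-> a ∈ TC x /\ ur a.
Proof. apply in_sep, definable_ker_pred. Qed.

Lemma is_set_ker x : is_set (ker x).
Proof. apply is_set_sep, definable_ker_pred. Qed.

Lemma definable_ker t : definable_term t -> definable_term (fun e => ker (t e)).
Proof.
  intros; apply (@definable_setof (fun e a => a ∈ TC (t e) /\ ur a)).
  - intros e; apply small_separation; definability.
  - definability.
Qed.
Hint Resolve definable_ker : definability.

Lemma is_ker_iff k x : is_ker k x <-> k = ker x.
Proof.
  split.
  - intros [H1 H2]; apply set_ext; [exact H1|apply is_set_ker|].
    intros a; rewrite H2, in_ker, in_tc_singleton_iff; tauto.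
  - intros ->; split; [apply is_set_ker|].
    intros a; rewrite in_ker, in_tc_singleton_iff; tauto.
Qed.

Lemma ker_ur a b : ur a -> b ∈ ker a <-> b = a.
Proof.
  intros Ha; rewrite in_ker, in_TC_iff. split.
  - intros [[|(y & Hy & _)] _]; [assumption|]. destruct (mem_is_set Hy Ha).
  - intros ->; auto.
Qed.

Lemma ker_set a x : is_set x -> a ∈ ker x <-> exists z, z ∈ x /\ a ∈ ker z.
Proof.
  intros Hx; rewrite in_ker, in_TC_iff; split.
  - intros [[->|(y & Hy & H)] Ha]; [destruct (Hx Ha)|]. exists y; rewrite in_ker; auto.
  - intros (y & Hy & H); apply in_ker in H; destruct H; eauto.
Qed.

Lemma ker_mem x y : y ∈ x -> ker y ⊆ ker x.
Proof. intros H a Ha; apply ker_set; [exact (mem_is_set H)|eauto]. Qed.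

Lemma ker_TC x y : y ∈ TC x -> ker y ⊆ ker x.
Proof.
  intros H a Ha; apply in_ker in Ha; apply in_ker; destruct Ha as [Ha Hu].
  split; [exact (TC_subset H Ha)|exact Hu].
Qed.

Lemma ker_upair a x y : a ∈ ker (upair x y) <-> a ∈ ker x \/ a ∈ ker y.
Proof.
  rewrite ker_set by apply is_set_upair; split.
  - intros (z & Hz & Ha); apply in_upair in Hz; destruct Hz; subst; auto.
  - intros [H|H]; [exists x|exists y]; rewrite in_upair; auto.
Qed.

Lemma ker_opair a x y : a ∈ ker (opair x y) <-> a ∈ ker x \/ a ∈ ker y.
Proof. unfold opair, sing; rewrite !ker_upair; tauto. Qed.

Lemma in_ker_set_of_ur a x : is_set_of_ur x -> a ∈ ker x <-> a ∈ x.
Proof.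
  intros [Hx H]; rewrite ker_set by exact Hx; split.
  - intros (z & Hz & Ha); apply ker_ur in Ha; [subst; exact Hz|auto].
  - intros Ha; exists a; split; [exact Ha|]; apply ker_ur; auto.
Qed.

(** ** The transport of objects along a function on urelements *)

(* A value [π y] is used only if it is unique, which makes the graph functional for
   an arbitrary parameter [π]. *)
Definition value_of π y v : Prop := maps π y v /\ forall v', maps π y v' -> v' = v.

(** One recursion serves two purposes: with [c] empty it is the action of a permutation, with [c]
    the singleton of a marker it is the coding needed for SVC. *)
Definition step_graph π c y w v : Prop :=
  (ur y /\ (value_of π y v \/ (~ (exists u, value_of π y u) /\ v = y))) \/
  (is_set y /\ v = cup w c).

Lemma step_graph_exists_unique π c y w : exists! v, step_graph π c y w v.
Proof.
  unfold step_graph. destruct (classic (ur y)) as [Hu|Hs].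
  - destruct (classic (exists u, value_of π y u)) as [(u & Hu')|N].
    + exists u; split; [auto|]. intros v [[_ [H|[N _]]]|[H _]].
      * symmetry; apply Hu', H.
      * destruct N; eauto.
      * destruct (H Hu).
    + exists y; split; [auto|]. intros v [[_ [H|[_ H]]]|[H _]].
      * destruct N; eauto.
      * auto.
      * destruct (H Hu).
  - exists (cup w c); split; [auto|]. intros v [[H _]|[_ H]]; [destruct (Hs H)|auto].
Qed.

Definition step π c y w : U := the (step_graph π c y w).

Lemma step_graph_iff π c y w v : v = step π c y w <-> step_graph π c y w v.
Proof.
  destruct (step_graph_exists_unique π c y w) as (u & Hu & Hu').
  assert (H : step_graph π c y w (step π c y w)).
  { unfold step, the; apply epsilon_spec; eauto. }
  split; [intros ->; exact H|]. intros Hv; rewrite <- (Hu' _ H); symmetry; apply Hu'; exact Hv.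
Qed.

Lemma definable_step π c : definable (fun e => e 0 = step π c (e 1) (e 2)).
Proof.
  apply (@definable_iff _ _ (fun e => step_graph π c (e 1) (e 2) (e 0))).
  - intros e; apply step_graph_iff.
  - unfold step_graph, value_of; definability.
Qed.

(** [transport π c] replaces urelements along [π] and adds the members of [c] to
    every set. *)
Definition transport π c : U -> U := rec (step π c).

Lemma definable_transport π c t :
  definable_term t -> definable_term (fun e => transport π c (t e)).
Proof. apply definable_rec, definable_step. Qed.

Lemma definable_transport_eq π c : definable (fun e => e 0 = transport π c (e 1)).
Proof. apply definable_rec_eq, definable_step. Qed.

Lemma transport_maps π c a v :
  is_function π -> ur a -> maps π a v -> transport π c a = v.
Proof.
  intros [_ Hf] Ha Hm; unfold transport; rewrite rec_eq by apply definable_step.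
  symmetry; apply step_graph_iff; left; split; [exact Ha|left].
  split; [exact Hm|]; intros v' H; exact (Hf a v' v H Hm).
Qed.

Lemma transport_off π c a : ur a -> ~ (exists v, maps π a v) -> transport π c a = a.
Proof.
  intros Ha N; unfold transport; rewrite rec_eq by apply definable_step.
  symmetry; apply step_graph_iff; left; split; [exact Ha|right].
  split; [|reflexivity]. intros (u & Hu & _); apply N; eauto.
Qed.

Lemma transport_set π c x :
  is_set x -> transport π c x = cup (img (transport π c) x) c.
Proof.
  intros Hx; unfold transport at 1; rewrite rec_eq by apply definable_step.
  symmetry; apply step_graph_iff; right; auto.
Qed.

Lemma is_set_transport π c x : is_set x -> is_set (transport π c x).
Proof. intros Hx; rewrite transport_set by exact Hx; apply is_set_cup. Qed.

Lemma in_transport π c x z : is_set x ->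
  z ∈ transport π c x <-> (exists u, u ∈ x /\ z = transport π c u) \/ z ∈ c.
Proof.
  intros Hx; rewrite transport_set by exact Hx.
  rewrite in_cup, in_img by apply definable_transport_eq; reflexivity.
Qed.

(** ** The action of a permutation *)

Definition act π : U -> U := transport π emp.

Lemma definable_act π t : definable_term t -> definable_term (fun e => act π (t e)).
Proof. apply definable_transport. Qed.
Hint Resolve definable_act : definability.

Lemma in_act π x z : is_set x -> z ∈ act π x <-> exists u, u ∈ x /\ z = act π u.
Proof.
  intros Hx; unfold act; rewrite in_transport by exact Hx; rewrite in_emp; tauto.
Qed.

Lemma is_set_act π x : is_set x -> is_set (act π x).
Proof. apply is_set_transport. Qed.

Lemma mem_act π x z : z ∈ x -> act π z ∈ act π x.
Proof. intros H; apply in_act; [exact (mem_is_set H)|eauto]. Qed.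

Lemma act_eq_img π x y :
  is_set x -> is_set y -> (forall z, z ∈ y <-> exists u, u ∈ x /\ z = act π u) ->
  act π x = y.
Proof.
  intros Hx Hy H; apply set_ext; [apply is_set_act; exact Hx|exact Hy|].
  intros z; rewrite in_act by exact Hx; rewrite H; reflexivity.
Qed.

(** For an empty kernel the hypothesis is vacuous, so pure objects such as ordinals are fixed by
    every permutation. *)
Lemma act_fix_ker π x : (forall a, a ∈ ker x -> act π a = a) -> act π x = x.
Proof.
  pattern x; revert x; apply mem_induction; [definability|].
  intros x IH H. destruct (classic (is_set x)) as [Hx|Hx].
  - assert (E : forall u, u ∈ x -> act π u = u).
    { intros u Hu; apply IH; [exact Hu|]. intros a Ha; apply H; exact (ker_mem Hu Ha). }
    apply act_eq_img; try exact Hx. intros z; split.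
    + intros Hz; exists z; split; [exact Hz|symmetry; auto].
    + intros (u & Hu & ->); rewrite E; assumption.
  - apply H, ker_ur; [exact (NNPP _ Hx)|reflexivity].
Qed.

Lemma act_upair π x y : act π (upair x y) = upair (act π x) (act π y).
Proof.
  apply act_eq_img; try apply is_set_upair. intros z; rewrite in_upair; split.
  - intros [->| ->]; [exists x|exists y]; rewrite in_upair; auto.
  - intros (u & Hu & ->); apply in_upair in Hu; destruct Hu; subst; auto.
Qed.

Lemma act_opair π x y : act π (opair x y) = opair (act π x) (act π y).
Proof. unfold opair, sing; rewrite !act_upair; reflexivity. Qed.

Lemma act_on π a v : is_function π -> ur a -> maps π a v -> act π a = v.
Proof. apply transport_maps. Qed.

Lemma act_off π a : ur a -> ~ (exists v, maps π a v) -> act π a = a.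
Proof. apply transport_off. Qed.

(** Links the relational action, given by approximations, to the total function [act]. In one
    direction ∈-induction shows that every approximation agrees with [act π]; in the other, the
    restriction of [act π] to [TC x] is an approximation. *)
Lemma acts_iff π x y : is_function π -> (acts π x y <-> y = act π x).
Proof.
  intros Hπ; split.
  - intros (f & ((_ & Hfun) & (d & Hd & Hdom) & Hf) & Hxy).
    revert y Hxy; pattern x; revert x; apply mem_induction; [definability|].
    intros x IH y Hxy. destruct (classic (is_set x)) as [Hx|Hx].
    + destruct (proj2 (Hf x y Hxy) Hx) as [Hy H].
      symmetry; apply act_eq_img; try assumption. intros z; rewrite H; split.
      * intros (u & Hu & Huz); exists u; split; [exact Hu|auto].
      * intros (u & Hu & ->); exists u; split; [exact Hu|].
        assert (Hud : u ∈ d).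
        { apply (proj2 Hd) with x; [|exact Hu]. apply (proj2 Hdom); eauto. }
        apply (proj2 Hdom) in Hud; destruct Hud as (v & Hv).
        rewrite <- (IH u Hu v Hv); exact Hv.
    + apply NNPP in Hx. destruct (proj1 (Hf x y Hxy) Hx) as [H|[N ->]].
      * symmetry; apply act_on; assumption.
      * symmetry; apply act_off; assumption.
  - intros ->.
    assert (S : small (fun p => exists z, z ∈ TC x /\ p = opair z (act π z))).
    { apply (@small_img (fun z => opair z (act π z))).
      change (definable_term (fun e => opair (e 0) (act π (e 0)))). definability. }
    destruct S as (f & Hf & Hf').
    assert (M : forall z w, maps f z w <-> z ∈ TC x /\ w = act π z).
    { intros z w; rewrite maps_iff, Hf'; split.
      - intros (z' & Hz & E); apply opair_inj in E; destruct E; subst; auto.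
      - intros [Hz ->]; eauto. }
    exists f; split; [|apply M; auto using TC_self]. repeat split.
    + exact Hf.
    + intros p Hp; apply Hf' in Hp; destruct Hp as (z & _ & ->).
      exists z, (act π z); apply is_opair_iff; reflexivity.
    + intros z w w' H H'; apply M in H, H'; destruct H, H'; congruence.
    + exists (TC x); split; [split; [apply is_set_TC|]|split; [apply is_set_TC|]].
      * intros z Hz w Hw; exact (TC_trans Hz Hw).
      * intros z; split; [intros Hz; exists (act π z); apply M; auto|].
        intros (w & Hw); apply M in Hw; tauto.
    + intros Hu; apply M in H; destruct H as [_ ->].
      destruct (classic (exists v, maps π z v)) as [(v & Hv)|N].
      * left; rewrite (act_on Hπ Hu Hv); exact Hv.
      * right; split; [exact N|apply act_off; assumption].
    + apply M in H; destruct H as [_ ->]; apply is_set_act; assumption.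
    + intros Hv; apply M in H; destruct H as [Hz ->].
      apply in_act in Hv; [|assumption]. destruct Hv as (u & Hu & ->); exists u; split; [exact Hu|].
      apply M; split; [exact (TC_trans Hz Hu)|reflexivity].
    + intros (u & Hu & Hv); apply M in H, Hv; destruct H as [_ ->], Hv as [_ ->].
      apply mem_act; exact Hu.
Qed.

(** ** Groups of permutations *)

Lemma is_permutation_function A π : is_permutation A π -> is_function π.
Proof. intros ((H & _) & _); exact H. Qed.

Lemma permutation_value A π a : is_permutation A π -> a ∈ A -> exists b, b ∈ A /\ maps π a b.
Proof.
  intros ((_ & _ & Hd) & _ & Ho) Ha. apply Hd in Ha; destruct Ha as (b & Hb).
  exists b; split; [apply Ho; eauto|exact Hb].
Qed.

Lemma permutation_maps_in A π a b : is_permutation A π -> maps π a b -> a ∈ A /\ b ∈ A.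
Proof.
  intros ((_ & _ & Hd) & _ & Ho) H; split; [apply Hd|apply Ho]; eauto.
Qed.

Lemma act_permutation_on A π a :
  is_set_of_ur A -> is_permutation A π -> a ∈ A -> maps π a (act π a) /\ act π a ∈ A.
Proof.
  intros HA Hπ Ha; destruct (permutation_value Hπ Ha) as (b & Hb & Hab).
  rewrite (act_on (is_permutation_function Hπ) (proj2 HA a Ha) Hab); auto.
Qed.

Lemma act_permutation_off A π a : is_permutation A π -> ur a -> ~ a ∈ A -> act π a = a.
Proof.
  intros Hπ Ha N; apply act_off; [exact Ha|]. intros (v & Hv).
  apply N, (permutation_maps_in Hπ Hv).
Qed.

Lemma ur_act A π a : is_set_of_ur A -> is_permutation A π -> ur a -> ur (act π a).
Proof.
  intros HA Hπ Ha; destruct (classic (a ∈ A)) as [H|H].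
  - apply (proj2 HA), (act_permutation_on HA Hπ H).
  - rewrite (act_permutation_off Hπ Ha H); exact Ha.
Qed.

Lemma ur_act_iff A π x : is_set_of_ur A -> is_permutation A π -> ur (act π x) <-> ur x.
Proof.
  intros HA Hπ; split; [|apply (ur_act HA Hπ)].
  intros H; apply NNPP; intros N; exact (is_set_act N H).
Qed.

Lemma inverse_permutation A π i :
  is_permutation A π -> is_inverse i π -> is_permutation A i.
Proof.
  intros (((Hr & Hf) & Hs & Hd) & Hi & Ho) [Hir H]. repeat split; auto.
  - apply Hir.
  - apply Hir.
  - intros x y y' H1 H2; apply H in H1, H2; exact (Hi _ _ _ H1 H2).
  - intros Hx; apply Ho in Hx; destruct Hx as (y & Hy); exists y; apply H; exact Hy.
  - intros (y & Hy); apply H in Hy; apply Ho; eauto.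
  - intros x x' y H1 H2; apply H in H1, H2; exact (Hf _ _ _ H1 H2).
  - intros Hx; apply Hd in Hx; destruct Hx as (y & Hy); exists y; apply H; exact Hy.
  - intros (y & Hy); apply H in Hy; apply Hd; eauto.
Qed.

Lemma comp_permutation A π σ ρ :
  is_permutation A π -> is_permutation A σ -> is_comp ρ π σ -> is_permutation A ρ.
Proof.
  intros Hπ Hσ [Hr H].
  pose proof Hπ as (((_ & Hf) & Hs & Hd) & Hi & Ho).
  pose proof Hσ as (((_ & Hf') & Hs' & Hd') & Hi' & Ho').
  repeat split; auto.
  - apply Hr.
  - apply Hr.
  - intros x y y' H1 H2; apply H in H1, H2; destruct H1 as (u & Hu & H1), H2 as (u' & Hu' & H2).
    rewrite (Hf' _ _ _ Hu Hu') in H1. exact (Hf _ _ _ H1 H2).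
  - intros Hx; destruct (permutation_value Hσ Hx) as (y & Hy & Hxy).
    destruct (permutation_value Hπ Hy) as (z & Hz & Hyz). exists z; apply H; eauto.
  - intros (z & Hz); apply H in Hz; destruct Hz as (y & Hy & _).
    apply (permutation_maps_in Hσ Hy).
  - intros x x' z H1 H2; apply H in H1, H2; destruct H1 as (u & Hu & H1), H2 as (u' & Hu' & H2).
    rewrite <- (Hi _ _ _ H1 H2) in Hu'. exact (Hi' _ _ _ Hu Hu').
  - intros Hz; apply Ho in Hz; destruct Hz as (y & Hyz).
    destruct (proj1 (Ho' y) (proj1 (permutation_maps_in Hπ Hyz))) as (x & Hx).
    exists x; apply H; eauto.
  - intros (x & Hx); apply H in Hx; destruct Hx as (y & _ & Hy).
    apply (permutation_maps_in Hπ Hy).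
Qed.

Lemma act_comp A π σ ρ x :
  is_set_of_ur A -> is_permutation A π -> is_permutation A σ -> is_comp ρ π σ ->
  act ρ x = act π (act σ x).
Proof.
  intros HA Hπ Hσ Hρ. pose proof (comp_permutation Hπ Hσ Hρ) as Pρ.
  pattern x; revert x; apply mem_induction; [definability|]. intros x IH.
  destruct (classic (is_set x)) as [Hx|Hx].
  - apply act_eq_img; [exact Hx|apply is_set_act, is_set_act; exact Hx|]. intros z.
    rewrite in_act by (apply is_set_act; exact Hx). split.
    + intros (u & Hu & ->). apply in_act in Hu; [|exact Hx]. destruct Hu as (v & Hv & ->).
      exists v; split; [exact Hv|symmetry; auto].
    + intros (u & Hu & ->). exists (act σ u); split; [apply mem_act; exact Hu|auto].
  - apply NNPP in Hx. destruct (classic (x ∈ A)) as [H|H].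
    + destruct (act_permutation_on HA Hσ H) as [H1 H2].
      destruct (act_permutation_on HA Hπ H2) as [H3 H4].
      apply act_on; [exact (is_permutation_function Pρ)|exact Hx|].
      apply (proj2 Hρ); eauto.
    + rewrite (act_permutation_off Pρ Hx H), (act_permutation_off Hσ Hx H).
      rewrite (act_permutation_off Hπ Hx H); reflexivity.
Qed.

Lemma act_inverse A π i x :
  is_set_of_ur A -> is_permutation A π -> is_inverse i π -> act i (act π x) = x.
Proof.
  intros HA Hπ Hi. pose proof (inverse_permutation Hπ Hi) as Pi.
  pattern x; revert x; apply mem_induction; [definability|]. intros x IH.
  destruct (classic (is_set x)) as [Hx|Hx].
  - apply act_eq_img; [apply is_set_act; exact Hx|exact Hx|]. intros z. split.
    + intros Hz; exists (act π z); split; [apply mem_act; exact Hz|symmetry; auto].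
    + intros (u & Hu & ->). apply in_act in Hu; [|exact Hx].
      destruct Hu as (v & Hv & ->); rewrite IH; assumption.
  - apply NNPP in Hx. destruct (classic (x ∈ A)) as [H|H].
    + destruct (act_permutation_on HA Hπ H) as [H1 H2].
      apply act_on; [exact (is_permutation_function Pi)|apply (ur_act HA Hπ Hx)|].
      apply Hi; exact H1.
    + rewrite (act_permutation_off Hπ Hx H), (act_permutation_off Pi Hx H); reflexivity.
Qed.

Lemma inverse_sym i π : is_rel π -> is_inverse i π -> is_inverse π i.
Proof. intros Hπ [_ H]; split; [exact Hπ|]. intros x y; symmetry; apply H. Qed.

Lemma act_identity A ι x : is_identity ι A -> is_set_of_ur A -> act ι x = x.
Proof.
  intros [Hr H] HA. apply act_fix_ker. intros a Ha; apply in_ker in Ha; destruct Ha as [_ Ha].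
  destruct (classic (a ∈ A)) as [Hin|N].
  - apply act_on; [|exact Ha|apply H; auto]. split; [exact Hr|].
    intros u v w H1 H2; apply H in H1, H2; destruct H1, H2; congruence.
  - apply act_off; [exact Ha|]. intros (v & Hv); apply H in Hv; tauto.
Qed.

Section PermutationGroup.
Context {A G : U} (HG : permutation_group A G).

Lemma group_permutation π : π ∈ G -> is_permutation A π.
Proof. apply HG. Qed.

Lemma group_function π : π ∈ G -> is_function π.
Proof. intros H; exact (is_permutation_function (group_permutation H)). Qed.

Lemma group_id : exists ι, ι ∈ G /\ forall x, act ι x = x.
Proof.
  destruct HG as (HA & _ & _ & (ι & Hι & H) & _).
  exists ι; split; [exact H|]; intros x; exact (act_identity x Hι HA).
Qed.

Lemma group_comp π σ : π ∈ G -> σ ∈ G ->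
  exists ρ, is_comp ρ π σ /\ ρ ∈ G /\ forall x, act ρ x = act π (act σ x).
Proof.
  intros Hπ Hσ; pose proof HG as (HA & _ & _ & _ & Hc & _).
  destruct (Hc π σ Hπ Hσ) as (ρ & Hρ & H); exists ρ; repeat split; try apply Hρ; auto.
  intros x; exact (act_comp x HA (group_permutation Hπ) (group_permutation Hσ) Hρ).
Qed.

Lemma group_inv π : π ∈ G ->
  exists i, is_inverse i π /\ i ∈ G /\ (forall x, act i (act π x) = x) /\
            (forall x, act π (act i x) = x).
Proof.
  intros Hπ; pose proof HG as (HA & _ & _ & _ & _ & Hi).
  destruct (Hi π Hπ) as (i & Hiπ & H); exists i; repeat split; try apply Hiπ; auto.
  - intros x; exact (act_inverse x HA (group_permutation Hπ) Hiπ).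
  - intros x; refine (act_inverse x HA (group_permutation H) (inverse_sym _ Hiπ)).
    apply (group_function Hπ).
Qed.

Lemma ur_act_group π x : π ∈ G -> ur (act π x) <-> ur x.
Proof. intros H; apply (ur_act_iff x (proj1 HG)), group_permutation; exact H. Qed.

Lemma act_inj π x y : π ∈ G -> act π x = act π y -> x = y.
Proof.
  intros H E; destruct (group_inv H) as (i & _ & _ & Hi & _).
  rewrite <- (Hi x), <- (Hi y), E; reflexivity.
Qed.

Lemma act_mem_iff π x y : π ∈ G -> act π x ∈ act π y <-> x ∈ y.
Proof.
  intros H; split; [|apply mem_act].
  destruct (group_inv H) as (i & _ & _ & Hi & _).
  intros Hm; rewrite <- (Hi x), <- (Hi y); apply mem_act; exact Hm.
Qed.

(** Closure under [H] already gives equality, because right inverses in [H] supply the preimages. *)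
Lemma act_stable_eq H x :
  (forall π, π ∈ H -> exists i, i ∈ H /\ forall x, act π (act i x) = x) ->
  is_set x -> (forall π z, π ∈ H -> z ∈ x -> act π z ∈ x) ->
  forall π, π ∈ H -> act π x = x.
Proof.
  intros Hinv Hx Hz π Hπ; apply act_eq_img; try exact Hx. intros z; split.
  - intros Hzx. destruct (Hinv π Hπ) as (i & Hi & E).
    exists (act i z); split; [auto|symmetry; apply E].
  - intros (u & Hu & ->); auto.
Qed.

Lemma act_TC π x y : π ∈ G -> y ∈ TC x -> act π y ∈ TC (act π x).
Proof.
  intros Hπ; revert y.
  apply (@TC_induction (fun y => act π y ∈ TC (act π x))); [apply TC_self| |definability].
  intros y z Hy Hz; exact (TC_trans Hy (mem_act π Hz)).
Qed.

Lemma act_TC_iff π x y : π ∈ G -> act π y ∈ TC (act π x) <-> y ∈ TC x.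
Proof.
  intros H; split; [|apply act_TC; exact H]. intros Hy.
  destruct (group_inv H) as (i & _ & Gi & Hi & _).
  rewrite <- (Hi x), <- (Hi y); apply act_TC; assumption.
Qed.

Lemma act_ker π x : π ∈ G -> act π (ker x) = ker (act π x).
Proof.
  intros H; apply act_eq_img; try apply is_set_ker. intros z.
  destruct (group_inv H) as (i & _ & Gi & Hi & Hi').
  rewrite in_ker; split.
  - intros [H1 H2]; exists (act i z); rewrite Hi', in_ker; repeat split.
    + rewrite <- (act_TC_iff _ _ H), Hi'; exact H1.
    + rewrite (ur_act_group z Gi); exact H2.
  - intros (u & Hu & ->); apply in_ker in Hu; destruct Hu as [H1 H2].
    rewrite (act_TC_iff _ _ H), (ur_act_group u H); auto.
Qed.

Definition symset x : U := sep G (fun π => acts π x x).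

Lemma definable_symset_pred x : definable (fun e => acts (e 0) x x).
Proof. definability. Qed.

Lemma in_symset x π : π ∈ symset x <-> π ∈ G /\ act π x = x.
Proof.
  unfold symset; rewrite in_sep by apply definable_symset_pred.
  split; intros [H1 H2]; split; auto.
  - apply (acts_iff x x (group_function H1)) in H2; symmetry; exact H2.
  - apply (acts_iff x x (group_function H1)); symmetry; exact H2.
Qed.

Lemma is_set_symset x : is_set (symset x).
Proof. apply is_set_sep, definable_symset_pred. Qed.

Lemma definable_symset t : definable_term t -> definable_term (fun e => symset (t e)).
Proof.
  intros; apply (@definable_setof (fun e π => π ∈ G /\ acts π (t e) (t e))).
  - intros e; apply small_separation; definability.
  - definability.
Qed.

Lemma is_sym_iff x s : is_sym G x s <-> s = symset x.
Proof.
  assert (E : forall π, π ∈ symset x <-> in_sym G x π).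
  { intros π; unfold symset; rewrite in_sep by apply definable_symset_pred; reflexivity. }
  split.
  - intros [H1 H2]; apply set_ext; [exact H1|apply is_set_symset|].
    intros π; rewrite E; apply H2.
  - intros ->; split; [apply is_set_symset|exact E].
Qed.

Lemma symset_group x : permutation_group A (symset x).
Proof.
  pose proof HG as (HA & _ & Hp & (ι & Hι & Hι') & _). split; [exact HA|].
  split; [apply is_set_symset|]. repeat apply conj.
  - intros π Hπ; apply Hp; apply in_symset in Hπ; tauto.
  - exists ι; split; [exact Hι|]. apply in_symset; split; [exact Hι'|].
    exact (act_identity x Hι HA).
  - intros π σ Hπ Hσ; apply in_symset in Hπ, Hσ; destruct Hπ as [Hπ E], Hσ as [Hσ E'].
    destruct (group_comp Hπ Hσ) as (ρ & H1 & H2 & H3); exists ρ; split; [exact H1|].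
    apply in_symset; split; [exact H2|]. rewrite H3, E', E; reflexivity.
  - intros π Hπ; apply in_symset in Hπ; destruct Hπ as [Hπ E].
    destruct (group_inv Hπ) as (i & H1 & H2 & H3 & _); exists i; split; [exact H1|].
    apply in_symset; split; [exact H2|]. rewrite <- E at 1; apply H3.
Qed.

End PermutationGroup.
Arguments symset G x : clear implicits.

Hint Resolve definable_symset : definability.

(** ** Ordinals *)

Lemma ordinal_is_set x : is_ordinal x -> is_set x.
Proof. intros [[H _] _]; exact H. Qed.

Lemma ordinal_mem x y : is_ordinal x -> y ∈ x -> is_ordinal y.
Proof.
  intros [[Hx Tx] H] Hy; split; [auto|]. intros z Hz; apply H, (Tx y Hy z Hz).
Qed.

Lemma ordinal_trans x y z : is_ordinal x -> y ∈ x -> z ∈ y -> z ∈ x.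
Proof. intros [[_ H] _] Hy Hz; exact (H y Hy z Hz). Qed.

(** Double ∈-induction: unless some member of one ordinal equals or exceeds the other ordinal, the
    two have the same members. *)
Lemma ordinal_linear x : forall y, is_ordinal x -> is_ordinal y -> x ∈ y \/ x = y \/ y ∈ x.
Proof.
  pattern x; revert x; apply mem_induction; [definability|]. intros x IHx y.
  pattern y; revert y; apply mem_induction; [definability|]. intros y IHy Ox Oy.
  destruct (classic (exists z, z ∈ x /\ (z = y \/ y ∈ z))) as [(z & Hz & Hzy)|Nx].
  { right; right; destruct Hzy as [<-|Hzy]; [exact Hz|]. exact (ordinal_trans Ox Hz Hzy). }
  destruct (classic (exists z, z ∈ y /\ (z = x \/ x ∈ z))) as [(z & Hz & Hzx)|Ny].
  { left; destruct Hzx as [<-|Hzx]; [exact Hz|]. exact (ordinal_trans Oy Hz Hzx). }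
  right; left; apply set_ext; try (apply ordinal_is_set; assumption).
  intros z; split; intros Hz.
  - destruct (IHx z Hz y (ordinal_mem Ox Hz) Oy) as [H|H]; [exact H|].
    destruct Nx; exists z; auto.
  - destruct (IHy z Hz Ox (ordinal_mem Oy Hz)) as [H|[H|H]]; [| |exact H];
      destruct Ny; exists z; auto.
Qed.

Lemma ker_ordinal x : is_ordinal x -> forall a, ~ a ∈ ker x.
Proof.
  pattern x; revert x; apply mem_induction; [definability|].
  intros x IH Ox a Ha. apply ker_set in Ha; [|apply ordinal_is_set; exact Ox].
  destruct Ha as (z & Hz & Ha). exact (IH z Hz (ordinal_mem Ox Hz) a Ha).
Qed.

Lemma least_ordinal (P : U -> Prop) : definable (fun e => P (e 0)) ->
  (exists x, is_ordinal x /\ P x) ->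
  exists! x, is_ordinal x /\ P x /\ forall y, y ∈ x -> ~ P y.
Proof.
  intros HP Hex.
  assert (E : exists x, is_ordinal x /\ P x /\ forall y, y ∈ x -> ~ P y).
  { apply NNPP; intros N. destruct Hex as (x & Ox & Px). revert Ox Px.
    assert (D : definable (fun e => is_ordinal (e 0) -> P (e 0) -> False)).
    { apply definable_imp; [definability|]. apply definable_imp; [exact HP|definability]. }
    pattern x; revert x; apply mem_induction; [exact D|].
    intros x IH Ox Px; apply N; exists x; split; [exact Ox|split; [exact Px|]].
    intros y Hy; exact (IH y Hy (ordinal_mem Ox Hy)). }
  destruct E as (x & Ox & Px & Hx); exists x; split; [auto|].
  intros y (Oy & Py & Hy). destruct (ordinal_linear Ox Oy) as [H|[H|H]]; auto.
  - destruct (Hy x H Px).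
  - destruct (Hx y H Py).
Qed.

Lemma burali_forti x : exists y, is_ordinal y /\ ~ y ∈ x.
Proof.
  apply NNPP; intros N.
  assert (D : definable (fun e : nat -> U => is_ordinal (e 0))) by definability.
  set (o := sep x (fun y => is_ordinal y)).
  assert (Ho : forall y, y ∈ o <-> is_ordinal y).
  { intros y; unfold o; rewrite in_sep by exact D. split; [tauto|].
    intros Hy; split; [|exact Hy]. apply NNPP; intros Ny; apply N; eauto. }
  apply (@mem_irrefl o), Ho. split; [split; [apply is_set_sep; exact D|]|].
  - intros y Hy z Hz; apply Ho in Hy; apply Ho; exact (ordinal_mem Hy Hz).
  - intros y Hy; apply Ho in Hy; exact (proj1 Hy).
Qed.

(** ** Well-ordering from choice *)

Section WellOrdering.
Context (x c : U) (Hc : is_function c).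

Definition rest w : U := sep x (fun z => ~ z ∈ w).

Lemma in_rest w z : z ∈ rest w <-> z ∈ x /\ ~ z ∈ w.
Proof.
  unfold rest; apply (in_sep x (P := fun z => ~ z ∈ w)); definability.
Qed.

Lemma definable_rest t : definable_term t -> definable_term (fun e => rest (t e)).
Proof.
  intros; apply (@definable_setof (fun e z => z ∈ x /\ ~ z ∈ t e)).
  - intros e; apply small_separation; definability.
  - definability.
Qed.
Hint Resolve definable_rest : definability.

(* The recursion picks an element of [x] not yet listed, and [x] itself, which is not
   an element of [x], when none is left. *)
Definition pick_graph w v : Prop :=
  maps c (rest w) v \/ (~ (exists u, maps c (rest w) u) /\ v = x).

Definition pick (_ w : U) : U := the (pick_graph w).

Lemma pick_iff y w v : v = pick y w <-> pick_graph w v.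
Proof.
  assert (H : pick_graph w (pick y w)).
  { unfold pick, the; apply epsilon_spec. unfold pick_graph.
    destruct (classic (exists u, maps c (rest w) u)) as [(u & Hu)|N]; eauto. }
  split; [intros ->; exact H|]. intros Hv; destruct Hv as [Hv|[N ->]], H as [H|[N' H]].
  - exact (proj2 Hc _ _ _ Hv H).
  - destruct N'; eauto.
  - destruct N; eauto.
  - symmetry; exact H.
Qed.

Lemma definable_pick : definable (fun e => e 0 = pick (e 1) (e 2)).
Proof.
  apply (@definable_iff _ _ (fun e => pick_graph (e 2) (e 0))).
  - intros e; apply pick_iff.
  - unfold pick_graph; definability.
Qed.

(** Zermelo's transfinite enumeration, obtained by ∈-recursion at every object rather than at
    ordinals alone. *)
Definition listing : U -> U := rec pick.

Lemma definable_listing : definable (fun e => e 0 = listing (e 1)).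
Proof. apply definable_rec_eq, definable_pick. Qed.

Lemma definable_listing_term t : definable_term t -> definable_term (fun e => listing (t e)).
Proof. apply definable_rec, definable_pick. Qed.
Hint Resolve definable_listing_term : definability.

Context (Hchoice : forall y z, maps c y z -> z ∈ y)
        (Hdom : forall y, is_set y -> y ⊆ x -> (exists z, z ∈ y) -> exists z, maps c y z).

Lemma listing_spec y :
  (listing y ∈ x /\ forall u, u ∈ y -> listing u <> listing y) \/
  (forall z, z ∈ x -> exists u, u ∈ y /\ z = listing u).
Proof.
  assert (H : pick_graph (img listing y) (listing y)).
  { apply (pick_iff y). unfold listing at 1; apply rec_eq, definable_pick. }
  destruct H as [H|[N _]].
  - left. apply Hchoice, in_rest in H; destruct H as [H1 H2]; split; [exact H1|].
    intros u Hu E; apply H2, in_img; [apply definable_listing|eauto].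
  - right; intros z Hz; apply NNPP; intros M; apply N, Hdom.
    + unfold rest; apply is_set_sep; definability.
    + intros u Hu; apply in_rest in Hu; tauto.
    + exists z; apply in_rest; split; [exact Hz|]. intros Hi; apply M.
      apply in_img in Hi; [exact Hi|apply definable_listing].
Qed.

(** If [x] were never exhausted, the listing would inject all ordinals into [x], and Replacement
    along the inverse would collect them in a set, against Burali-Forti. At the least exhausting
    ordinal, all earlier values still lie in [x]. *)
Lemma listing_exhausts : exists o, is_ordinal o /\
  (forall i, i ∈ o -> listing i ∈ x) /\ (forall z, z ∈ x -> exists i, i ∈ o /\ z = listing i).
Proof.
  set (P := fun o => forall z, z ∈ x -> exists u, u ∈ o /\ z = listing u).
  assert (DP : definable (fun e => P (e 0))) by (unfold P; definability).
  assert (Hex : exists o, is_ordinal o /\ P o).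
  { apply NNPP; intros N.
    assert (L : forall o, is_ordinal o ->
              listing o ∈ x /\ forall u, u ∈ o -> listing u <> listing o).
    { intros o Oo; destruct (listing_spec o) as [H|H]; [exact H|]. destruct N; eauto. }
    assert (D : definable (fun e => exists o, is_ordinal o /\ e 0 = listing o)) by definability.
    destruct (@small_replacement (fun o z => is_ordinal o /\ z = listing o)
                (sep x (fun z => exists o, is_ordinal o /\ z = listing o))) as (s & _ & Hs).
    - definability.
    - intros z Hz; rewrite in_sep in Hz by exact D. destruct Hz as (_ & o & Oo & E).
      exists o; split; [auto|]. intros o' [Oo' E'].
      destruct (ordinal_linear Oo Oo') as [H|[H|H]]; [|exact H|].
      + destruct (proj2 (L o' Oo') o H); congruence.
      + destruct (proj2 (L o Oo) o' H); congruence.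
    - destruct (burali_forti s) as (o & Oo & No). apply No, Hs; exists (listing o).
      split; [|auto]. rewrite in_sep by exact D; split; [apply L; exact Oo|eauto]. }
  destruct (least_ordinal DP Hex) as (o & (Oo & Po & Ho) & _).
  exists o; split; [exact Oo|split; [|exact Po]]. intros i Hi.
  destruct (listing_spec i) as [[H _]|H]; [exact H|]. destruct (Ho i Hi H).
Qed.

End WellOrdering.

Lemma AC_ordinal_surjection x : AC U ->
  exists (o : U) (h : U -> U), is_ordinal o /\ definable (fun e => e 0 = h (e 1)) /\
    (forall i, i ∈ o -> h i ∈ x) /\ (forall z, z ∈ x -> exists i, i ∈ o /\ z = h i).
Proof.
  intros HAC.
  assert (D : definable (fun e : nat -> U => exists z, z ∈ e 0)) by definability.
  destruct (HAC (sep (pow x) (fun y => exists z, z ∈ y))) as (c & [Hf Hd] & Hc).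
  { apply is_set_sep; exact D. }
  { intros y Hy; rewrite in_sep in Hy by exact D; tauto. }
  assert (Hmem : forall y z, maps c y z -> z ∈ y).
  { intros y z Hyz; apply (Hc y z); [|exact Hyz]. apply (proj2 Hd); eauto. }
  assert (Hdom : forall y, is_set y -> y ⊆ x -> (exists z, z ∈ y) -> exists z, maps c y z).
  { intros y Hy Hyx Hz; apply (proj2 Hd). rewrite in_sep by exact D; rewrite in_pow; auto. }
  destruct (listing_exhausts Hf Hmem Hdom) as (o & Oo & H1 & H2).
  exists o, (listing x c). split; [exact Oo|split; [apply definable_listing; exact Hf|auto]].
Qed.

(** ** Ranks and the hierarchy over a set of urelements *)

Definition rank_step (_ w : U) : U := Union (img succ w).

Lemma definable_succ_eq : definable (fun e => e 0 = succ (e 1)).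
Proof. definability. Qed.

Lemma definable_rank_step : definable (fun e => e 0 = rank_step (e 1) (e 2)).
Proof.
  unfold rank_step. apply definable_eq; [definability|].
  apply definable_Union, definable_img; [apply definable_succ_eq|definability].
Qed.

Definition rank : U -> U := rec rank_step.

Lemma definable_rank_eq : definable (fun e => e 0 = rank (e 1)).
Proof. apply definable_rec_eq, definable_rank_step. Qed.

Lemma definable_rank t : definable_term t -> definable_term (fun e => rank (t e)).
Proof. apply definable_rec, definable_rank_step. Qed.
Hint Resolve definable_rank : definability.

Lemma in_rank x z : z ∈ rank x <-> exists y, y ∈ x /\ (z ∈ rank y \/ z = rank y).
Proof.
  unfold rank at 1; rewrite rec_eq by apply definable_rank_step.
  fold rank; unfold rank_step; rewrite in_Union; split.
  - intros (s & Hs & Hz). apply in_img in Hs; [|apply definable_succ_eq].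
    destruct Hs as (r & Hr & ->). apply in_img in Hr; [|apply definable_rank_eq].
    destruct Hr as (y & Hy & ->). apply in_succ in Hz; eauto.
  - intros (y & Hy & Hz). exists (succ (rank y)); split; [|apply in_succ; exact Hz].
    apply in_img; [apply definable_succ_eq|]. exists (rank y); split; [|reflexivity].
    apply in_img; [apply definable_rank_eq|]. eauto.
Qed.

Lemma is_set_rank x : is_set (rank x).
Proof.
  unfold rank; rewrite rec_eq by apply definable_rank_step; apply is_set_Union.
Qed.

Lemma rank_ordinal x : is_ordinal (rank x).
Proof.
  pattern x; revert x; apply mem_induction; [definability|]. intros x IH.
  split; [split; [apply is_set_rank|]|].
  - intros y Hy z Hz; apply in_rank in Hy; apply in_rank. destruct Hy as (u & Hu & [Hy| ->]).
    + exists u; split; [exact Hu|left; exact (ordinal_trans (IH u Hu) Hy Hz)].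
    + exists u; auto.
  - intros y Hy; apply in_rank in Hy; destruct Hy as (u & Hu & [Hy| ->]).
    + exact (proj2 (IH u Hu) y Hy).
    + exact (proj1 (IH u Hu)).
Qed.

Lemma rank_mem x y : y ∈ x -> rank y ∈ rank x.
Proof. intros H; apply in_rank; eauto. Qed.

Definition level_step E (_ w : U) : U := cup E (pow (Union w)).

Lemma definable_level_step E : definable (fun e => e 0 = level_step E (e 1) (e 2)).
Proof. unfold level_step; definability. Qed.

(** For an ordinal [x], [level E x] is [V_(x+1)(E)]. *)
Definition level E : U -> U := rec (level_step E).

Lemma definable_level E t : definable_term t -> definable_term (fun e => level E (t e)).
Proof. apply definable_rec, definable_level_step. Qed.
Hint Resolve definable_level : definability.

Lemma in_level E x z :
  z ∈ level E x <->
  z ∈ E \/ (is_set z /\ forall w, w ∈ z -> exists u, u ∈ x /\ w ∈ level E u).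
Proof.
  unfold level at 1; rewrite rec_eq by apply definable_level_step.
  fold (level E); unfold level_step; rewrite in_cup, in_pow.
  apply or_iff_compat_l, and_iff_compat_l.
  assert (D : definable (fun e => e 0 = level E (e 1))).
  { apply definable_rec_eq, definable_level_step. }
  split; intros H w Hw.
  - apply H, in_Union in Hw; destruct Hw as (y & Hy & Hw).
    apply in_img in Hy; [|exact D]. destruct Hy as (u & Hu & ->); eauto.
  - destruct (H w Hw) as (u & Hu & Hwu). apply in_Union; exists (level E u).
    split; [|exact Hwu]. apply in_img; [exact D|eauto].
Qed.

(** Levels are indexed by arbitrary objects, so that each object with kernel in [E] lies in the
    level indexed by itself; this lemma moves to an ordinal index, which permutations fix. *)
Lemma level_rank E x : level E x ⊆ level E (rank x).
Proof.
  pattern x; revert x; apply mem_induction; [definability|]. intros x IH z Hz.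
  apply in_level in Hz; apply in_level. destruct Hz as [Hz|[H1 H2]]; [auto|right].
  split; [exact H1|]. intros w Hw; destruct (H2 w Hw) as (u & Hu & Hwu).
  exists (rank u); split; [exact (rank_mem Hu)|exact (IH u Hu w Hwu)].
Qed.

Lemma mem_level E x : ker x ⊆ E -> x ∈ level E x.
Proof.
  pattern x; revert x; apply mem_induction; [definability|]. intros x IH H.
  apply in_level; destruct (classic (ur x)) as [Hu|Hs].
  - left; apply H, ker_ur; auto.
  - right; split; [exact Hs|]. intros w Hw; exists w; split; [exact Hw|].
    apply (IH w Hw); intros a Ha; exact (H a (ker_mem Hw Ha)).
Qed.

Lemma ker_level E x : is_set_of_ur E -> forall z, z ∈ level E x -> ker z ⊆ E.
Proof.
  intros HE; pattern x; revert x; apply mem_induction; [definability|].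
  intros x IH z Hz a Ha. apply in_level in Hz; destruct Hz as [Hz|[H1 H2]].
  - apply ker_ur in Ha; [subst; exact Hz|apply HE; exact Hz].
  - apply ker_set in Ha; [|exact H1]. destruct Ha as (w & Hw & Ha).
    destruct (H2 w Hw) as (u & Hu & Hwu). exact (IH u Hu w Hwu a Ha).
Qed.

Lemma act_level π E x : act π E = E -> forall z, z ∈ level E x -> act π z ∈ level E (act π x).
Proof.
  intros HE; pattern x; revert x; apply mem_induction; [definability|].
  intros x IH z Hz. apply in_level in Hz; apply in_level. destruct Hz as [Hz|[H1 H2]].
  - left; rewrite <- HE; apply mem_act; exact Hz.
  - right; split; [apply is_set_act; exact H1|]. intros w Hw.
    apply in_act in Hw; [|exact H1]. destruct Hw as (v & Hv & ->).
    destruct (H2 v Hv) as (u & Hu & Hvu). exists (act π u).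
    split; [apply mem_act; exact Hu|exact (IH u Hu v Hvu)].
Qed.

(* Collection is not available in ZFU, but Scott's trick works for objects whose kernel
   is included in a fixed set [E]. *)
Lemma bounded_kernel_collection (P : U -> U -> Prop) E X :
  definable (fun e => P (e 0) (e 1)) ->
  exists s, (forall o, o ∈ s -> is_ordinal o) /\
    forall y, y ∈ X -> forall t, ker t ⊆ E -> P y t ->
      exists o u, o ∈ s /\ u ∈ level E o /\ P y u.
Proof.
  intros HP.
  set (Q := fun y o => exists u, u ∈ level E o /\ P y u).
  set (D := fun y => exists o, is_ordinal o /\ Q y o).
  assert (HP' : forall t s, definable_term t -> definable_term s ->
            definable (fun e => P (t e) (s e))).
  { intros t s; apply definable_app2; exact HP. }
  assert (DQ : forall t s, definable_term t -> definable_term s ->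
            definable (fun e => Q (t e) (s e))).
  { intros t s Ht Hs; unfold Q.
    apply (@definable_ex _ (fun u e => u ∈ level E (s e) /\ P (t e) u)).
    apply definable_and; [definability|apply HP'; definability]. }
  assert (DD : definable (fun e => D (e 0))).
  { unfold D. apply (@definable_ex _ (fun o e => is_ordinal o /\ Q (e 0) o)).
    apply definable_and; [definability|apply DQ; definability]. }
  (* Replacement needs a unique value, so [y] is sent to the least ordinal whose level contains a
     witness instead of to a witness. *)
  destruct (@small_replacement
    (fun o y => is_ordinal o /\ Q y o /\ forall o', o' ∈ o -> ~ Q y o') (sep X D)) as (s & _ & Hs).
  - apply definable_and; [definability|]. apply definable_and; [apply DQ; definability|].
    apply (@definable_all _ (fun o e => o ∈ e 0 -> ~ Q (e 1) o)).
    apply definable_imp; [definability|]. apply definable_not, DQ; definability.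
  - intros y Hy; rewrite in_sep in Hy by exact DD; apply least_ordinal; [|apply Hy].
    apply DQ; definability.
  - exists s; split.
    + intros o Ho; apply Hs in Ho; destruct Ho as (_ & _ & Ho & _); exact Ho.
    + intros y Hy t Ht HPt.
      assert (Hex : exists o, is_ordinal o /\ Q y o).
      { exists (rank t); split; [apply rank_ordinal|]. exists t; split; [|exact HPt].
        apply level_rank, mem_level; exact Ht. }
      destruct (@least_ordinal (Q y)) as (o & (Oo & (u & Hu & Hyu) & Ho) & _);
        [apply DQ; definability|exact Hex|].
      exists o, u; split; [|auto]. apply Hs; exists y; rewrite in_sep by exact DD.
      split; [split; [exact Hy|exact Hex]|]. split; [exact Oo|split; [exists u; auto|exact Ho]].
Qed.

(** ** The levels [V_α(A)] in the sense of a structure *)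

(** Applied inside the model, this bounds the kernels of members of V(E) without comparing the
    hierarchies of the model and of [U]: only a transitive set with its urelements in [E] has to be
    carried over. *)
Lemma in_V_transitive E x : is_set_of_ur E -> in_V E x ->
  exists t, transitive t /\ x ∈ t /\ forall a, a ∈ t -> ur a -> a ∈ E.
Proof.
  intros HE (α & v & (f & (Hf & (δ & Oδ & Hd) & Hseq) & Hv) & Hx).
  assert (C : forall β, forall v, maps f β v ->
            transitive v /\ forall a, a ∈ v -> ur a -> a ∈ E).
  { intros β; pattern β; revert β; apply mem_induction; [definability|].
    intros β IH u Hu. destruct (Hseq β u Hu) as (H0 & HS & HL).
    assert (Hβ : β ∈ δ) by (apply (proj2 Hd); eauto).
    pose proof (ordinal_mem Oδ Hβ) as Oβ.
    assert (Hval : forall γ, γ ∈ β -> exists w, maps f γ w).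
    { intros γ Hγ; apply (proj2 Hd); exact (ordinal_trans Oδ Hβ Hγ). }
    destruct (classic (is_empty β)) as [He|Hne].
    { rewrite (H0 He); split; [split; [apply HE|]|auto].
      intros a Ha b Hb; destruct (mem_is_set Hb (proj2 HE a Ha)). }
    destruct (classic (exists γ, is_succ β γ)) as [(γ & Hγ)|Ns].
    - assert (Hγβ : γ ∈ β) by (apply (proj2 Hγ); auto).
      destruct (Hval γ Hγβ) as (w & Hw). destruct (HS γ w Hγ Hw) as [Su Eu].
      destruct (IH γ Hγβ w Hw) as [[Sw Tw] Uw]. split; [split; [exact Su|]|].
      + intros y Hy z Hz. apply Eu in Hy; apply Eu. destruct Hy as [[Sy Hy]|Hy].
        * apply Hy in Hz. destruct (classic (ur z)) as [Uz|Sz]; [right; auto|left].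
          split; [exact Sz|apply Tw; exact Hz].
        * destruct (mem_is_set Hz (proj2 HE y Hy)).
      + intros a Ha Ua; apply Eu in Ha; destruct Ha as [[Sa _]|Ha]; [destruct (Sa Ua)|exact Ha].
    - destruct HL as [Su Eu]; [split; auto|]. split; [split; [exact Su|]|].
      + intros y Hy z Hz; apply Eu in Hy; apply Eu.
        destruct Hy as (γ & w & Hγ & Hw & Hy). exists γ, w; repeat split; auto.
        destruct (IH γ Hγ w Hw) as [[_ Tw] _]. exact (Tw y Hy z Hz).
      + intros a Ha Ua; apply Eu in Ha; destruct Ha as (γ & w & Hγ & Hw & Ha).
        destruct (IH γ Hγ w Hw) as [_ Uw]; auto. }
  exists v; destruct (C α v Hv) as [H1 H2]; auto.
Qed.

(** ** The small-kernel permutation model *)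

End SetTheory.

Arguments symset {U HU} G x.

#[local] Hint Resolve definable_upair definable_sing definable_opair definable_Union
  definable_cup definable_succ definable_pow definable_TC definable_ker definable_act definable_symset definable_level : definability.

Section Model.
Context {U : structure} {HU : ZFU U} {A G F I : U}.
Implicit Types x y z w f π σ ρ i : U.
Context (HG : permutation_group A G) (HF : normal_filter A G F) (HI : flexible_ideal G I).

Notation inM := (in_small_kernel_model G F I).
Notation M := (small_kernel_model G F I).

(** * Criteria for membership in the model *)

Lemma symmetric_iff x : symmetric G F x <-> symset G x ∈ F.
Proof.
  split.
  - intros (s & Hs & H); apply is_sym_iff in Hs; subst; exact H.
  - intros H; exists (symset G x); split; [apply is_sym_iff; reflexivity|exact H].
Qed.

Lemma inM_iff x : inM x <-> (forall y, y ∈ TC x -> symset G y ∈ F) /\ ker x ∈ I.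
Proof.
  split.
  - intros [H (k & Hk & Hk')]; apply is_ker_iff in Hk; subst; split; [|exact Hk'].
    intros y Hy; apply symmetric_iff, H, in_tc_singleton_iff; exact Hy.
  - intros [H Hk]; split.
    + intros y Hy; apply symmetric_iff, H, in_tc_singleton_iff; exact Hy.
    + exists (ker x); split; [apply is_ker_iff; reflexivity|exact Hk].
Qed.

Lemma ideal_cup X Y : X ∈ I -> Y ∈ I -> cup X Y ∈ I.
Proof.
  intros HX HY; destruct (fi_union HI HX HY) as (Z & [HZ HZ'] & H).
  replace (cup X Y) with Z; [exact H|]. apply set_ext; [exact HZ|apply is_set_cup|].
  intros z; rewrite HZ', in_cup; reflexivity.
Qed.

Lemma ker_ideal x k : k ∈ I -> ker x ⊆ k -> ker x ∈ I.
Proof. intros Hk H; exact (fi_subset HI Hk (@is_set_ker U HU x) H). Qed.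

Lemma filter_mem_group H π : H ∈ F -> π ∈ H -> π ∈ G.
Proof. intros HH; apply (nf_subgroup HF HH). Qed.

Lemma filter_inter H K : H ∈ F -> K ∈ F ->
  exists L, L ∈ F /\ forall π, π ∈ L -> π ∈ H /\ π ∈ K.
Proof.
  intros HH HK; destruct (nf_inter HF HH HK) as (L & [_ HL] & H').
  exists L; split; [exact H'|]; intros π; apply HL.
Qed.

Lemma symset_filter H x : H ∈ F -> (forall π, π ∈ H -> act π x = x) -> symset G x ∈ F.
Proof.
  intros HH Hx; apply (nf_super HF (H := H)); [exact HH| |].
  - split; [apply symset_group; exact HG|]. intros π Hπ; apply (in_symset HG) in Hπ; tauto.
  - intros π Hπ; apply (in_symset HG); split; [exact (filter_mem_group HH Hπ)|auto].
Qed.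

Lemma symset_filter_closed H x :
  H ∈ F -> is_set x -> (forall π z, π ∈ H -> z ∈ x -> act π z ∈ x) -> symset G x ∈ F.
Proof.
  intros HH Hx Hz; apply (symset_filter HH), act_stable_eq; try assumption.
  intros π Hπ. destruct (group_inv (proj1 (nf_subgroup HF HH)) Hπ) as (i & _ & Hi & _ & E).
  exists i; auto.
Qed.

(** The conjugate of [symset G x] by [π] fixes [act π x], and normality keeps this conjugate in the
    filter. *)
Lemma symset_act π x : π ∈ G -> symset G x ∈ F -> symset G (act π x) ∈ F.
Proof.
  intros Hπ Hx; destruct (nf_conj HF Hx Hπ) as (K & [_ HK] & HKF).
  apply (symset_filter HKF). intros ρ Hρ; apply HK in Hρ.
  destruct Hρ as (σ & Hσ & i & t & Hi & Ht & Hρ). apply (in_symset HG) in Hσ.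
  destruct Hσ as [Hσ E].
  pose proof (group_permutation HG Hπ) as Pπ.
  pose proof (group_permutation HG Hσ) as Pσ.
  pose proof (inverse_permutation Pπ Hi) as Pi.
  pose proof (proj1 HG) as HA.
  rewrite (act_comp _ HA (comp_permutation Pπ Pσ Ht) Pi Hρ).
  rewrite (act_inverse _ HA Pπ Hi), (act_comp _ HA Pπ Pσ Ht), E; reflexivity.
Qed.

Lemma inM_TC x y : inM x -> y ∈ TC x -> inM y.
Proof.
  rewrite !inM_iff; intros [H1 H2] Hy; split.
  - intros z Hz; exact (H1 z (TC_subset Hy Hz)).
  - exact (ker_ideal H2 (ker_TC Hy)).
Qed.

Lemma inM_mem x y : inM x -> y ∈ x -> inM y.
Proof. intros Hx Hy; exact (inM_TC Hx (TC_trans (TC_self x) Hy)). Qed.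

Lemma inM_symset x : inM x -> symset G x ∈ F.
Proof. intros H; apply inM_iff in H; apply H, TC_self. Qed.

Lemma inM_ker x : inM x -> ker x ∈ I.
Proof. intros H; apply inM_iff in H; apply H. Qed.

(** Heredity is inherited from the members, so only [x] itself needs a stabilizer in the filter and
    a bound on its kernel. *)
Lemma inM_intro x k :
  (forall z, z ∈ x -> inM z) -> symset G x ∈ F -> k ∈ I -> ker x ⊆ k -> inM x.
Proof.
  intros Hx Hs Hk Hkx; apply inM_iff; split; [|exact (ker_ideal Hk Hkx)].
  intros y Hy; apply in_TC_iff in Hy; destruct Hy as [->|(z & Hz & Hy)]; [exact Hs|].
  apply inM_symset, (inM_TC (Hx z Hz) Hy).
Qed.

Lemma inM_act π x : π ∈ G -> inM x -> inM (act π x).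
Proof.
  intros Hπ; rewrite !inM_iff; intros [H1 H2]; split.
  - destruct (group_inv HG Hπ) as (i & _ & Hi & E & E').
    intros y Hy. rewrite <- (E' y) in *. apply (act_TC_iff HG) in Hy; [|exact Hπ].
    apply symset_act; auto.
  - rewrite <- (act_ker HG _ Hπ).
    pose proof (fi_invariant HI Hπ) as HπI.
    apply (acts_iff _ _ (group_function HG Hπ)) in HπI; rewrite HπI.
    apply mem_act; exact H2.
Qed.

(* Flexibility is used only here: an urelement of [ker w] outside [k] could be moved
   by a permutation fixing [k] and the rest of [ker w]. *)
Lemma ker_supported w k :
  ker w ∈ I -> k ∈ I ->
  (forall π, π ∈ G -> (forall b, b ∈ k -> act π b = b) -> act π w = w) ->
  ker w ⊆ k.
Proof.
  intros Hw Hk Hfix a Ha; apply NNPP; intros N.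
  assert (D : definable (fun e => e 0 <> a)) by definability.
  set (B := sep (cup k (ker w)) (fun b => b <> a)).
  assert (HB : forall b, b ∈ B <-> (b ∈ k \/ b ∈ ker w) /\ b <> a).
  { intros b; unfold B; rewrite in_sep by exact D; rewrite in_cup; reflexivity. }
  destruct (@fi_flexible U G I HI B a (cup k (ker w))) as (π & b & [Hπ HπB] & Hab & Nab).
  - apply is_set_sep; exact D.
  - split; [apply is_set_cup|]. intros b; rewrite HB, in_cup.
    destruct (classic (b = a)) as [->|]; tauto.
  - apply ideal_cup; assumption.
  - rewrite HB; tauto.
  - pose proof (group_function HG Hπ) as Fπ.
    apply (acts_iff _ _ Fπ) in Hab; subst b.
    assert (E : forall b, b ∈ B -> act π b = b).
    { intros b Hb; apply HπB, (acts_iff _ _ Fπ) in Hb; auto. }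
    assert (Ew : act π w = w).
    { apply Hfix; [exact Hπ|]. intros b Hb; apply E, HB; split; [auto|].
      intros ->; exact (N Hb). }
    (* Since [π] fixes [w], it maps [ker w] to itself; so [act π a] lies in [ker w], differs from
       [a], hence belongs to [B] and is fixed by [π]. Injectivity then forces [act π a = a]. *)
    apply Nab, (act_inj HG Hπ), E, HB; split; [|exact Nab].
    right. rewrite <- Ew, <- (act_ker HG _ Hπ); apply mem_act; exact Ha.
Qed.

Lemma inM_pure x : (forall a, ~ a ∈ ker x) -> inM x.
Proof.
  intros H; apply inM_iff; split.
  - intros y Hy; destruct (nf_nonempty HF) as (K & HK). apply (symset_filter HK).
    intros π _; apply act_fix_ker; intros a Ha; destruct (H a (ker_TC Hy Ha)).
  - destruct (fi_empty HI) as (X & HX & HXI). apply (ker_ideal HXI).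
    intros a Ha; destruct (H a Ha).
Qed.

Lemma inM_upair x y : inM x -> inM y -> inM (upair x y).
Proof.
  intros Hx Hy; apply inM_intro with (cup (ker x) (ker y)).
  - intros z Hz; apply in_upair in Hz; destruct Hz; subst; assumption.
  - destruct (filter_inter (inM_symset Hx) (inM_symset Hy)) as (L & HL & H).
    apply (symset_filter HL). intros π Hπ; destruct (H π Hπ) as [H1 H2].
    apply (in_symset HG) in H1, H2. rewrite act_upair; f_equal; tauto.
  - apply ideal_cup; apply inM_ker; assumption.
  - intros a Ha; apply ker_upair in Ha; apply in_cup; exact Ha.
Qed.

Lemma inM_opair x y : inM x -> inM y -> inM (opair x y).
Proof. intros; repeat apply inM_upair; assumption. Qed.

Lemma inM_opair_inv x y : inM (opair x y) -> inM x /\ inM y.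
Proof.
  intros H; assert (Hp : inM (upair x y)).
  { apply (inM_mem H), in_upair; auto. }
  split; apply (inM_mem Hp), in_upair; auto.
Qed.

(** ** Satisfaction in the model *)

Definition val (m : M) : U := proj1_sig m.

Lemma val_inM (m : M) : inM (val m).
Proof. exact (proj2_sig m). Qed.

Definition mk x (H : inM x) : M := exist _ x H.

Lemma val_inj (m n : M) : val m = val n -> m = n.
Proof.
  destruct m as [x Hx], n as [y Hy]; simpl; intros E; subst; f_equal; apply proof_irrelevance.
Qed.

(** Relativized satisfaction over environments in [U]. Unlike [sat] in the model, whose environments
    live in a subtype, it can be expressed by a formula of [U] and compared with its image under a
    permutation. *)
Fixpoint rsat (e : nat -> U) (p : formula) : Prop :=
  match p with
  | fmem i j => e i ∈ e j
  | feq i j => e i = e j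
  | fur i => ur (e i)
  | fbot => False
  | fimp p q => rsat e p -> rsat e q
  | fall p => forall x, inM x -> rsat (scons x e) p
  end.

(** The filter is closed under finite intersections and the ideal under finite unions, so the
    infinitely many entries of an environment must first be cut down to finitely many. *)
Lemma rsat_bound p : exists N, forall e e' : nat -> U,
  (forall n, n < N -> e n = e' n) -> rsat e p <-> rsat e' p.
Proof.
  induction p as [i j|i j|i| |p [N IHp] q [N' IHq]|p [N IHp]]; simpl.
  - exists (S (i + j)); intros e e' H; rewrite !H by lia; reflexivity.
  - exists (S (i + j)); intros e e' H; rewrite !H by lia; reflexivity.
  - exists (S i); intros e e' H; rewrite H by lia; reflexivity.
  - exists 0; reflexivity.
  - exists (N + N'); intros e e' H.
    rewrite (IHp e e') by (intros; apply H; lia).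
    rewrite (IHq e e') by (intros; apply H; lia). reflexivity.
  - exists N; intros e e' H. split; intros K x Hx; specialize (K x Hx);
      (apply (IHp (scons x e) (scons x e')); [|exact K]) ||
      (apply (IHp (scons x e) (scons x e')) in K; [exact K|]);
      intros [|n] Hn; simpl; try apply H; auto; lia.
Qed.

Lemma rsat_ext p (e e' : nat -> U) : (forall n, e n = e' n) -> rsat e p <-> rsat e' p.
Proof. intros H; rewrite (functional_extensionality e e' H); reflexivity. Qed.

Lemma sat_rsat p (e : nat -> M) : sat e p <-> rsat (fun n => val (e n)) p.
Proof.
  revert e; induction p as [i j|i j|i| |p IHp q IHq|p IHp]; intros e; simpl; try reflexivity.
  - split; [intros ->; reflexivity|apply val_inj].
  - rewrite IHp, IHq; reflexivity.
  - split.
    + intros H x Hx; specialize (H (mk Hx)); rewrite IHp in H.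
      revert H; apply rsat_ext; intros [|n]; reflexivity.
    + intros H x; rewrite IHp; specialize (H (val x) (val_inM x)).
      revert H; apply rsat_ext; intros [|n]; reflexivity.
Qed.

Lemma definable_rsat p : definable (fun e => rsat e p).
Proof.
  induction p as [i j|i j|i| |p IHp q IHq|p IHp]; simpl; try solve [definability].
  apply (@definable_all _ (fun x e => inM x -> rsat (scons x e) p)).
  apply definable_imp; [definability|].
  apply (definable_iff (Q := fun e => rsat e p)); [|exact IHp].
  intros e; apply rsat_ext; intros [|n]; reflexivity.
Qed.

Lemma rsat_act p π (e : nat -> U) : π ∈ G -> rsat (fun n => act π (e n)) p <-> rsat e p.
Proof.
  intros Hπ; revert e; induction p as [i j|i j|i| |p IHp q IHq|p IHp]; intros e; simpl.
  - apply (act_mem_iff HG); exact Hπ.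
  - split; [apply (act_inj HG Hπ)|intros ->; reflexivity].
  - apply (ur_act_group HG); exact Hπ.
  - reflexivity.
  - rewrite IHp, IHq; reflexivity.
  - assert (E : forall x, rsat (scons (act π x) (fun n => act π (e n))) p <-> rsat (scons x e) p).
    { intros x; rewrite <- (IHp (scons x e)); apply rsat_ext; intros [|n]; reflexivity. }
    split; intros H x Hx.
    + apply E, H, inM_act; assumption.
    + destruct (group_inv HG Hπ) as (i & _ & Hi & _ & E').
      rewrite <- (E' x); apply E, H, inM_act; assumption.
Qed.

Lemma filter_env (e : nat -> M) N :
  exists H, H ∈ F /\ forall π, π ∈ H -> forall n, n < N -> act π (val (e n)) = val (e n).
Proof.
  induction N as [|N (H & HH & IH)].
  - destruct (nf_nonempty HF) as (K & HK); exists K; split; [exact HK|]; intros; lia.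
  - destruct (filter_inter HH (inM_symset (val_inM (e N)))) as (L & HL & HL').
    exists L; split; [exact HL|]. intros π Hπ n Hn; destruct (HL' π Hπ) as [H1 H2].
    apply (in_symset HG) in H2. destruct (Nat.eq_dec n N) as [->|]; [tauto|].
    apply IH; [exact H1|lia].
Qed.

Lemma ideal_env (e : nat -> M) N :
  exists k, k ∈ I /\ forall n, n < N -> ker (val (e n)) ⊆ k.
Proof.
  induction N as [|N (k & Hk & IH)].
  - destruct (fi_empty HI) as (X & _ & HX); exists X; split; [exact HX|]; intros; lia.
  - exists (cup k (ker (val (e N)))); split.
    + apply ideal_cup; [exact Hk|apply inM_ker, val_inM].
    + intros n Hn a Ha; apply in_cup. destruct (Nat.eq_dec n N) as [->|]; [auto|].
      left; apply (IH n); [lia|exact Ha].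
Qed.

(* The permutations fixing [x] and the parameters of [p], and a member of the ideal
   supporting them. *)
Lemma formula_support p (e : nat -> M) (x : M) :
  exists H k, H ∈ F /\ k ∈ I /\ ker (val x) ⊆ k /\
    (forall π, π ∈ H -> act π (val x) = val x) /\
    (forall π, π ∈ G -> π ∈ H \/ (forall b, b ∈ k -> act π b = b) -> forall w z,
       rsat (scons (act π w) (scons (act π z) (fun n => val (e n)))) p <->
       rsat (scons w (scons z (fun n => val (e n)))) p).
Proof.
  destruct (rsat_bound p) as (N & HN).
  destruct (filter_env e N) as (H & HH & HHe).
  destruct (filter_inter HH (inM_symset (val_inM x))) as (L & HL & HL').
  destruct (ideal_env e N) as (k & Hk & Hke).
  exists L, (cup k (ker (val x))); repeat apply conj.
  - exact HL.
  - apply ideal_cup; [exact Hk|apply inM_ker, val_inM].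
  - intros a Ha; apply in_cup; auto.
  - intros π Hπ; apply HL' in Hπ; destruct Hπ as [_ Hπ]; apply (in_symset HG) in Hπ; tauto.
  - intros π Hπ Hfix w z.
    rewrite <- (rsat_act p (scons w (scons z (fun n => val (e n)))) Hπ). apply HN.
    intros [|[|n]] Hn; simpl; try reflexivity. symmetry; destruct Hfix as [Hfix|Hfix].
    + apply HHe; [apply HL'; exact Hfix|lia].
    + apply act_fix_ker; intros a Ha; apply Hfix, in_cup; left; apply (Hke n); [lia|exact Ha].
Qed.

Lemma definable_rsat1 p (e0 : nat -> U) : definable (fun e => rsat (scons (e 0) e0) p).
Proof.
  apply (@definable_iff _ _ (fun e => rsat
    (fun n => match (match n with 0 => inl 0 | S k => inr (e0 k) end) with
              | inl m => e m | inr x => x end) p)).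
  - intros e; apply rsat_ext; intros [|n]; reflexivity.
  - apply (@definable_subst _ (fun e => rsat e p)), definable_rsat.
Qed.

Lemma definable_rsat2 p (e0 : nat -> U) :
  definable (fun e => rsat (scons (e 0) (scons (e 1) e0)) p).
Proof.
  apply (@definable_iff _ _ (fun e => rsat
    (fun n => match (match n with 0 => inl 0 | 1 => inl 1 | S (S k) => inr (e0 k) end) with
              | inl m => e m | inr x => x end) p)).
  - intros e; apply rsat_ext; intros [|[|n]]; reflexivity.
  - apply (@definable_subst _ (fun e => rsat e p)), definable_rsat.
Qed.

Lemma model_replacement p (e : nat -> M) (x : M) :
  (forall z : M, z ∈ x -> exists! w : M, sat (scons w (scons z e)) p) ->
  exists y : M, is_set y /\
    forall w : M, w ∈ y <-> exists z : M, z ∈ x /\ sat (scons w (scons z e)) p.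
Proof.
  intros Hfun. set (e0 := fun n => val (e n)).
  (* Requiring [inM w] turns uniqueness of the value in the model into uniqueness in [U], where
     Replacement is then applied. *)
  set (R := fun w z => inM w /\ rsat (scons w (scons z e0)) p).
  assert (ER : forall w z : M, sat (scons w (scons z e)) p <-> R (val w) (val z)).
  { intros w z; rewrite sat_rsat; unfold R.
    rewrite (@rsat_ext p _ (scons (val w) (scons (val z) e0))).
    - split; [intros H; split; [apply val_inM|exact H]|tauto].
    - intros [|[|n]]; reflexivity. }
  assert (HR : forall z, z ∈ val x -> exists! w, R w z).
  { intros z Hz. pose (z' := mk (inM_mem (val_inM x) Hz) : M).
    destruct (Hfun z' Hz) as (w & Hw & Hu). exists (val w); split; [apply (ER w z'), Hw|].
    intros v Hv. change v with (val (mk (proj1 Hv))); f_equal; apply Hu, ER; exact Hv. }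
  assert (DR : definable (fun e => R (e 0) (e 1))).
  { apply definable_and; [definability|apply definable_rsat2]. }
  destruct (small_replacement DR HR) as (y & Hy & Hy').
  destruct (formula_support p e x) as (H & k & HH & Hk & Hkx & Hx & HE).
  assert (Ry : forall π w z, π ∈ G -> π ∈ H \/ (forall b, b ∈ k -> act π b = b) ->
      R w z -> R (act π w) (act π z)).
  { intros π w z Hπ Hf [H1 H2]; split; [apply inM_act; assumption|].
    apply HE; assumption. }
  assert (My : inM y).
  { apply inM_intro with k; [| |exact Hk|].
    - intros w Hw; apply Hy' in Hw; destruct Hw as (z & _ & Hw & _); exact Hw.
    - apply (symset_filter_closed HH Hy). intros π w Hπ Hw; apply Hy' in Hw; apply Hy'.
      destruct Hw as (z & Hz & Hw); exists (act π z); split.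
      + rewrite <- (Hx π Hπ); apply mem_act; exact Hz.
      + apply Ry; auto. exact (filter_mem_group HH Hπ).
    - intros a Ha; apply ker_set in Ha; [|exact Hy]. destruct Ha as (w & Hw & Ha).
      apply Hy' in Hw; destruct Hw as (z & Hz & Hw). revert a Ha.
      (* A permutation fixing [k] pointwise fixes [z] and the parameters; as [w] is the only value
         at [z], it is fixed too, and flexibility bounds its kernel by [k]. *)
      apply ker_supported; [apply inM_ker, Hw|exact Hk|]. intros π Hπ Hf.
      destruct (HR z Hz) as (w' & _ & Hu). rewrite <- (Hu w Hw). symmetry; apply Hu.
      assert (Ez : act π z = z).
      { apply act_fix_ker; intros a Ha; apply Hf, Hkx, (ker_mem Hz Ha). }
      rewrite <- Ez. rewrite (Hu w Hw). apply Ry; auto. }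
  exists (mk My); split; [exact Hy|]. intros w; split.
  - intros Hw; apply Hy' in Hw; destruct Hw as (z & Hz & Hw).
    exists (mk (inM_mem (val_inM x) Hz)); split; [exact Hz|apply ER; exact Hw].
  - intros (z & Hz & Hw); apply Hy'; exists (val z); split; [exact Hz|apply ER; exact Hw].
Qed.

Lemma model_separation p (e : nat -> M) (x : M) :
  exists y : M, is_set y /\ forall z : M, z ∈ y <-> z ∈ x /\ sat (scons z e) p.
Proof.
  set (e0 := fun n => val (e n)).
  assert (D : definable (fun e => rsat (scons (e 0) e0) p)) by apply definable_rsat1.
  set (y := sep (val x) (fun z => rsat (scons z e0) p)).
  assert (Hy : forall z, z ∈ y <-> z ∈ val x /\ rsat (scons z e0) p).
  { intros z; unfold y; rewrite in_sep by exact D; reflexivity. }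
  destruct (rsat_bound p) as (N & HN).
  destruct (filter_env e N) as (H & HH & HHe).
  destruct (filter_inter HH (inM_symset (val_inM x))) as (L & HL & HL').
  assert (My : inM y).
  { apply inM_intro with (ker (val x)).
    - intros z Hz; apply Hy in Hz; exact (inM_mem (val_inM x) (proj1 Hz)).
    - apply (symset_filter_closed HL); [apply is_set_sep; exact D|].
      intros π z Hπ Hz; apply Hy in Hz; apply Hy. destruct Hz as [Hz Hs].
      destruct (HL' π Hπ) as [H1 H2]; apply (in_symset HG) in H2; destruct H2 as [Gπ Ex]. split.
      + rewrite <- Ex; apply mem_act; exact Hz.
      + rewrite <- (rsat_act p _ Gπ) in Hs. revert Hs; apply HN.
        intros [|n] Hn; simpl; [reflexivity|]. symmetry; apply HHe; [exact H1|lia].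
    - apply inM_ker, val_inM.
    - intros a Ha; apply ker_set in Ha; [|apply is_set_sep; exact D].
      destruct Ha as (z & Hz & Ha); apply Hy in Hz; exact (ker_mem (proj1 Hz) Ha). }
  exists (mk My); split; [apply is_set_sep; exact D|]. intros z.
  rewrite sat_rsat. rewrite (@rsat_ext p _ (scons (val z) e0)); [apply Hy|].
  intros [|n]; reflexivity.
Qed.

(** * The remaining axioms in the model *)

Lemma is_upair_val (p x y : M) : is_upair p x y <-> val p = upair (val x) (val y).
Proof.
  rewrite <- is_upair_iff; split; intros [H1 H2]; (split; [exact H1|intros w]).
  - split; intros Hw.
    + destruct (proj1 (H2 (mk (inM_mem (val_inM p) Hw))) Hw) as [E|E];
        [left|right]; exact (f_equal val E).
    + destruct Hw; subst w; [apply (proj2 (H2 x))|apply (proj2 (H2 y))]; auto.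
  - split; intros Hw.
    + destruct (proj1 (H2 (val w)) Hw) as [E|E]; [left|right]; apply val_inj; exact E.
    + apply (proj2 (H2 (val w))). destruct Hw as [->| ->]; auto.
Qed.

Lemma ker_Union x : ker (Union x) ⊆ ker x.
Proof.
  intros a Ha; apply ker_set in Ha; [|apply is_set_Union]. destruct Ha as (z & Hz & Ha).
  apply in_Union in Hz; destruct Hz as (y & Hy & Hz).
  exact (ker_mem Hy (ker_mem Hz Ha)).
Qed.

Lemma act_fixed_mem π x z : act π x = x -> z ∈ x -> act π z ∈ x.
Proof. intros E Hz; rewrite <- E; apply mem_act; exact Hz. Qed.

Lemma inM_Union x : inM x -> inM (Union x).
Proof.
  intros Hx; apply inM_intro with (ker x).
  - intros z Hz; apply in_Union in Hz; destruct Hz as (y & Hy & Hz).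
    exact (inM_mem (inM_mem Hx Hy) Hz).
  - apply (symset_filter_closed (inM_symset Hx)); [apply is_set_Union|].
    intros π z Hπ Hz; apply (in_symset HG) in Hπ; apply in_Union in Hz; apply in_Union.
    destruct Hz as (y & Hy & Hz); exists (act π y); split; [|apply mem_act; exact Hz].
    apply act_fixed_mem; tauto.
  - apply inM_ker; exact Hx.
  - apply ker_Union.
Qed.

Lemma model_powerset (x : M) : is_set x -> exists u : M, is_set u /\
  forall z : M, z ∈ u <-> is_set z /\ z ⊆ x.
Proof.
  intros Sx.
  assert (D : definable (fun e => inM (e 0))) by definability.
  set (u := sep (pow (val x)) (fun z => inM z)).
  assert (Hu : forall z, z ∈ u <-> (is_set z /\ z ⊆ val x) /\ inM z).
  { intros z; unfold u; rewrite in_sep by exact D; rewrite in_pow; reflexivity. }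
  assert (Su : is_set u) by (apply is_set_sep; exact D).
  assert (Mu : inM u).
  { apply inM_intro with (ker (val x)).
    - intros z Hz; apply Hu in Hz; tauto.
    - apply (symset_filter_closed (inM_symset (val_inM x)) Su).
      intros π z Hπ Hz; apply (in_symset HG) in Hπ; destruct Hπ as [Gπ E].
      apply Hu in Hz; apply Hu; destruct Hz as [[H1 H2] H3]; split; [split|].
      + apply is_set_act; exact H1.
      + intros w Hw; apply in_act in Hw; [|exact H1]. destruct Hw as (v & Hv & ->).
        apply act_fixed_mem; auto.
      + apply inM_act; assumption.
    - apply inM_ker, val_inM.
    - intros a Ha; apply ker_set in Ha; [|exact Su]. destruct Ha as (z & Hz & Ha).
      apply Hu in Hz; destruct Hz as [[H1 H2] _]. apply ker_set in Ha; [|exact H1].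
      destruct Ha as (w & Hw & Ha). exact (ker_mem (H2 w Hw) Ha). }
  exists (mk Mu); split; [exact Su|]. intros z; split.
  - intros Hz; apply Hu in Hz; destruct Hz as [[H1 H2] _]; split; [exact H1|].
    intros w Hw; exact (H2 (val w) Hw).
  - intros [H1 H2]; apply Hu; split; [split; [exact H1|]|apply val_inM].
    intros w Hw; exact (H2 (mk (inM_mem (val_inM z) Hw)) Hw).
Qed.

Lemma ker_emp a : ~ a ∈ ker emp.
Proof.
  intros Ha; apply ker_set in Ha; [|apply is_set_emp].
  destruct Ha as (z & Hz & _); exact (proj1 (in_emp z) Hz).
Qed.

Lemma ker_succ a x : a ∈ ker (succ x) -> a ∈ ker x.
Proof.
  intros Ha; apply ker_set in Ha; [|apply is_set_succ]. destruct Ha as (z & Hz & Ha).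
  apply in_succ in Hz; destruct Hz as [Hz| ->]; [exact (ker_mem Hz Ha)|exact Ha].
Qed.

Lemma ker_omega a : ~ a ∈ ker omega.
Proof.
  assert (S : is_set omega) by exact (mem_is_set emp_in_omega).
  intros Ha; apply ker_set in Ha; [|exact S].
  destruct Ha as (n & Hn & Ha); revert Ha; pattern n; revert n Hn; apply omega_ind.
  - definability.
  - apply ker_emp.
  - intros n _ IH Ha; apply IH, ker_succ, Ha.
Qed.

Lemma model_infinity : exists x : M, is_set x /\
  (exists z : M, is_empty z /\ z ∈ x) /\
  (forall y : M, y ∈ x -> exists z : M, is_succ z y /\ z ∈ x).
Proof.
  exists (mk (inM_pure ker_omega)). split; [exact (mem_is_set emp_in_omega)|split].
  - exists (mk (inM_pure ker_emp)); split; [|exact emp_in_omega].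
    split; [exact is_set_emp|]. intros z Hz; exact (proj1 (in_emp _) Hz).
  - intros y Hy; pose proof (succ_in_omega Hy) as Hs.
    assert (Ms : inM (succ (val y))) by exact (inM_mem (inM_pure ker_omega) Hs).
    exists (mk Ms); split; [|exact Hs]. split; [apply is_set_succ|].
    intros w; split.
    + intros Hw; apply in_succ in Hw; destruct Hw as [Hw|Hw]; [left; exact Hw|].
      right; apply val_inj; exact Hw.
    + intros Hw; apply in_succ; destruct Hw as [Hw|Hw]; [left; exact Hw|].
      right; exact (f_equal val Hw).
Qed.

Theorem model_ZFU : ZFU M.
Proof.
  split.
  - intros a x Ha Hx; exact (zfu_urelements HU Ha Hx).
  - intros x y Hx Hy H; apply val_inj, set_ext; [exact Hx|exact Hy|].
    intros z; split; intros Hz.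
    + exact (proj1 (H (mk (inM_mem (val_inM x) Hz))) Hz).
    + exact (proj2 (H (mk (inM_mem (val_inM y) Hz))) Hz).
  - intros x (y & Hy). destruct (@zfu_foundation U HU (val x)) as (z & Hz & N).
    { exists (val y); exact Hy. }
    exists (mk (inM_mem (val_inM x) Hz)); split; [exact Hz|].
    intros (w & Hw & Hwz); apply N; exists (val w); split; assumption.
  - intros x y; exists (mk (inM_upair (val_inM x) (val_inM y))).
    apply is_upair_val; reflexivity.
  - intros x; exists (mk (inM_Union (val_inM x))); split; [apply is_set_Union|].
    intros z; split.
    + intros Hz; apply in_Union in Hz; destruct Hz as (y & Hy & Hz).
      exists (mk (inM_mem (val_inM x) Hy)); split; assumption.
    + intros (y & Hy & Hz); apply in_Union; exists (val y); split; assumption.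
  - exact model_powerset.
  - exact model_infinity.
  - exact model_separation.
  - exact model_replacement.
Qed.

(** * Absoluteness and closure for pairs, maps, products and kernels *)

Lemma is_opair_val (p x y : M) : is_opair p x y <-> val p = opair (val x) (val y).
Proof.
  split.
  - intros (s & t & H1 & H2 & H3). rewrite is_upair_val in *.
    rewrite H3, H1, H2; reflexivity.
  - intros E. exists (mk (inM_upair (val_inM x) (val_inM x))).
    exists (mk (inM_upair (val_inM x) (val_inM y))).
    rewrite !is_upair_val; repeat split; exact E.
Qed.

Lemma maps_val (f x y : M) : maps f x y <-> maps (val f) (val x) (val y).
Proof.
  rewrite maps_iff; split.
  - intros (p & H & Hp); apply is_opair_val in Hp; rewrite <- Hp; exact H.
  - intros H; exists (mk (inM_opair (val_inM x) (val_inM y))); split; [exact H|].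
    apply is_opair_val; reflexivity.
Qed.

Lemma inM_maps f x y : inM f -> maps f x y -> inM x /\ inM y.
Proof. intros Hf H; apply maps_iff in H; exact (inM_opair_inv (inM_mem Hf H)). Qed.

Lemma inM_prod x y : inM x -> inM y -> inM (prod x y).
Proof.
  intros Hx Hy; apply inM_intro with (cup (ker x) (ker y)).
  - intros z Hz; apply in_prod in Hz; destruct Hz as (a & b & Ha & Hb & ->).
    apply inM_opair; [exact (inM_mem Hx Ha)|exact (inM_mem Hy Hb)].
  - destruct (filter_inter (inM_symset Hx) (inM_symset Hy)) as (L & HL & H).
    apply (symset_filter_closed HL (@is_set_prod U HU x y)).
    intros π z Hπ Hz; destruct (H π Hπ) as [H1 H2]; apply (in_symset HG) in H1, H2.
    apply in_prod in Hz; destruct Hz as (a & b & Ha & Hb & ->).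
    rewrite act_opair; apply opair_in_prod; split; apply act_fixed_mem; tauto.
  - apply ideal_cup; apply inM_ker; assumption.
  - intros c Hc; apply ker_set in Hc; [|apply is_set_prod]. destruct Hc as (z & Hz & Hc).
    apply in_prod in Hz; destruct Hz as (a & b & Ha & Hb & ->).
    apply ker_opair in Hc; apply in_cup.
    destruct Hc as [Hc|Hc]; [left; exact (ker_mem Ha Hc)|right; exact (ker_mem Hb Hc)].
Qed.

Lemma inM_kernel x : inM x -> inM (ker x).
Proof.
  intros Hx; apply inM_intro with (ker x).
  - intros a Ha; apply in_ker in Ha; exact (inM_TC Hx (proj1 Ha)).
  - apply (symset_filter (inM_symset Hx)). intros π Hπ; apply (in_symset HG) in Hπ.
    destruct Hπ as [Hπ E]; rewrite (act_ker HG) by exact Hπ; rewrite E; reflexivity.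
  - apply inM_ker; exact Hx.
  - assert (Hs : is_set_of_ur (ker x)).
    { split; [apply is_set_ker|]. intros b Hb; apply in_ker in Hb; tauto. }
    intros a Ha; exact (proj1 (@in_ker_set_of_ur U HU a (ker x) Hs) Ha).
Qed.

Lemma act_ordinal π o : is_ordinal o -> act π o = o.
Proof. intros Ho; apply act_fix_ker; intros a Ha; destruct (ker_ordinal Ho Ha). Qed.

(** ** Stabilizers occurring over a fixed kernel *)

(** Collection is applied with index set [F] and the relation that [t] is in the model and has
    stabilizer [K]. Keeping all objects of the model in the levels obtained, rather than selecting
    witnesses, makes [S] invariant under every permutation in [G] that fixes [E]. *)
Lemma stabilizer_representatives E : inM E -> is_set_of_ur E ->
  exists S, inM S /\ is_set S /\
    forall t, inM t -> ker t ⊆ E -> exists s, s ∈ S /\ symset G s = symset G t.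
Proof.
  intros ME HE.
  destruct (@bounded_kernel_collection U HU (fun K t => inM t /\ symset G t = K) E F)
    as (s & Os & Hs); [definability|].
  assert (DM : definable (fun e => inM (e 0))) by definability.
  assert (DL : definable (fun e => e 0 = level E (e 1))) by definability.
  set (S := sep (Union (img (level E) s)) (fun t => inM t)).
  assert (HS : forall t, t ∈ S <-> (exists o, o ∈ s /\ t ∈ level E o) /\ inM t).
  { intros t; unfold S; rewrite in_sep by exact DM; rewrite in_Union.
    apply and_iff_compat_r; split.
    - intros (v & Hv & Ht); apply in_img in Hv; [|exact DL].
      destruct Hv as (o & Ho & ->); eauto.
    - intros (o & Ho & Ht); exists (level E o); split; [|exact Ht].
      apply in_img; [exact DL|eauto]. }
  assert (SS : is_set S) by (apply is_set_sep; exact DM).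
  exists S; split; [|split; [exact SS|]].
  (* [ker E] has the same members as [E], and it is known to be in the ideal because [E] is in the
     model. *)
  - apply inM_intro with (ker E).
    + intros t Ht; apply HS in Ht; tauto.
    + apply (symset_filter_closed (inM_symset ME) SS). intros π t Hπ Ht.
      apply (in_symset HG) in Hπ; destruct Hπ as [Hπ EE].
      apply HS in Ht; apply HS; destruct Ht as [(o & Ho & Ht) Mt]; split.
      * exists o; split; [exact Ho|]. rewrite <- (act_ordinal π (Os o Ho)).
        apply act_level; assumption.
      * apply inM_act; assumption.
    + apply inM_ker; exact ME.
    + intros a Ha; apply in_ker_set_of_ur; [exact HE|]. apply ker_set in Ha; [|exact SS].
      destruct Ha as (t & Ht & Ha); apply HS in Ht; destruct Ht as [(o & _ & Ht) _].
      exact (ker_level HE Ht Ha).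
  - intros t Mt Ht.
    destruct (Hs (symset G t) (inM_symset Mt) t Ht (conj Mt eq_refl))
      as (o & u & Ho & Hu & Mu & E').
    exists u; split; [|exact E']. apply HS; split; [eauto|exact Mu].
Qed.

(** ** Encoding objects by objects with kernel in [E] *)

Section Encoding.
Context {E B f : U} (ME : inM E) (HE : is_set_of_ur E) (Mf : inM f)
  (Ff : is_function f) (If : injective f)
  (HB : forall b, b ∈ B -> exists v, maps f b v)
  (HfE : forall b v, maps f b v -> ker v ⊆ E).

(* A pure set outside [TC f], by Russell's argument: it marks the codes of sets. *)
Definition marker : U := sep (TC f) (fun c => ker c = emp).

Lemma definable_pure : definable (fun e : nat -> U => ker (e 0) = emp).
Proof. definability. Qed.

Lemma in_marker c : c ∈ marker <-> c ∈ TC f /\ ker c = emp.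
Proof. unfold marker; rewrite in_sep by exact definable_pure; reflexivity. Qed.

Lemma ker_marker a : ~ a ∈ ker marker.
Proof.
  intros Ha; apply ker_set in Ha; [|apply is_set_sep, definable_pure].
  destruct Ha as (c & Hc & Ha). apply in_marker in Hc; destruct Hc as [_ Hc].
  rewrite Hc in Ha; exact (proj1 (in_emp a) Ha).
Qed.

Lemma marker_fresh : ~ marker ∈ TC f.
Proof.
  intros H; apply (@mem_irrefl U HU marker), in_marker; split; [exact H|].
  apply set_ext; [apply is_set_ker|apply is_set_emp|].
  intros a; rewrite in_emp; split; [apply ker_marker|tauto].
Qed.

(** The marker belongs to the code of every set and to no value of [f], so a code reveals whether it
    comes from a set or from an urelement of [B]. *)
Definition code : U -> U := transport f (sing marker).

Lemma definable_code t : definable_term t -> definable_term (fun e => code (t e)).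
Proof. apply definable_transport. Qed.
Hint Resolve definable_code : definability.

Lemma maps_TC b v : maps f b v -> v ∈ TC f.
Proof.
  intros H; apply maps_iff in H.
  assert (H1 : upair b v ∈ opair b v) by (apply in_upair; auto).
  assert (H2 : v ∈ upair b v) by (apply in_upair; auto).
  exact (TC_trans (TC_trans (TC_trans (TC_self f) H) H1) H2).
Qed.

Lemma code_ur y : ur y -> ker y ⊆ B -> maps f y (code y).
Proof.
  intros Hy Hk; destruct (HB (b := y)) as (v & Hv); [apply Hk, ker_ur; auto|].
  unfold code; rewrite (transport_maps _ Ff Hy Hv); exact Hv.
Qed.

Lemma in_code y z : is_set y -> z ∈ code y <-> (exists u, u ∈ y /\ z = code u) \/ z = marker.
Proof. intros Hy; unfold code; rewrite in_transport by exact Hy; rewrite in_sing; reflexivity. Qed.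

Lemma marker_in_code y : ker y ⊆ B -> marker ∈ code y <-> is_set y.
Proof.
  intros Hk; split.
  - intros H Hy; apply marker_fresh, (TC_trans (maps_TC (code_ur Hy Hk)) H).
  - intros Hy; apply in_code; auto.
Qed.

(** Ensures that the marker inside the code of a set is not mistaken for the code of a member. *)
Lemma code_neq_marker y : ker y ⊆ B -> code y <> marker.
Proof.
  intros Hk Eq; destruct (classic (ur y)) as [Hy|Hy].
  - apply marker_fresh; rewrite <- Eq; exact (maps_TC (code_ur Hy Hk)).
  - apply (@mem_irrefl U HU marker). rewrite <- Eq at 2; apply marker_in_code; assumption.
Qed.

Lemma code_inj y : forall y', ker y ⊆ B -> ker y' ⊆ B -> code y = code y' -> y = y'.
Proof.
  pattern y; revert y; apply mem_induction; [definability|]. intros y IH y' Hk Hk' Eq.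
  assert (ES : is_set y <-> is_set y').
  { rewrite <- (marker_in_code Hk), <- (marker_in_code Hk'), Eq; reflexivity. }
  destruct (classic (ur y)) as [Hy|Hy].
  - assert (Hy' : ur y') by (apply NNPP; intros N; apply (proj2 ES N Hy)).
    pose proof (code_ur Hy Hk) as H1; pose proof (code_ur Hy' Hk') as H2.
    rewrite Eq in H1; exact (If H1 H2).
  - pose proof (proj1 ES Hy) as Hy'. apply set_ext; [exact Hy|exact Hy'|].
    assert (K : forall x u, ker x ⊆ B -> u ∈ x -> ker u ⊆ B).
    { intros x u Hx Hu a Ha; exact (Hx a (ker_mem Hu Ha)). }
    intros z; split; intros Hz.
    + assert (H : code z ∈ code y') by (rewrite <- Eq; apply in_code; eauto).
      apply in_code in H; [|exact Hy']. destruct H as [(u & Hu & H)|H].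
      * rewrite (IH z Hz u); eauto.
      * destruct (code_neq_marker (K y z Hk Hz) H).
    + assert (H : code z ∈ code y) by (rewrite Eq; apply in_code; eauto).
      apply in_code in H; [|exact Hy]. destruct H as [(u & Hu & H)|H].
      * rewrite <- (IH u Hu z); eauto.
      * destruct (code_neq_marker (K y' z Hk' Hz) H).
Qed.

(** Fixing [f] means permuting its graph, and the marker is pure, so [π] commutes with each step of
    the recursion that defines codes. For an urelement outside the domain of [f], the inverse of [π]
    shows that its image is outside as well. *)
Lemma act_code π y : π ∈ G -> act π f = f -> act π (code y) = code (act π y).
Proof.
  intros Hπ Hf.
  assert (Em : act π marker = marker).
  { apply act_fix_ker; intros a Ha; destruct (ker_marker Ha). }
  assert (Mπ : forall b v, maps f (act π b) (act π v) <-> maps f b v).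
  { intros b v; rewrite !maps_iff, <- act_opair, <- Hf at 1; apply (act_mem_iff HG); exact Hπ. }
  pattern y; revert y; apply mem_induction; [definability|]. intros y IH.
  destruct (classic (ur y)) as [Hy|Hy].
  - assert (Hy' : ur (act π y)) by (apply (ur_act_group HG); assumption).
    destruct (classic (exists v, maps f y v)) as [(v & Hv)|N].
    + unfold code; rewrite (transport_maps _ Ff Hy Hv). symmetry.
      apply transport_maps; [exact Ff|exact Hy'|apply Mπ; exact Hv].
    + unfold code; rewrite !transport_off; auto.
      intros (v & Hv); apply N.
      destruct (group_inv HG Hπ) as (i & _ & _ & _ & Ei).
      exists (act i v); apply Mπ; rewrite Ei; exact Hv.
  - pose proof (is_set_act (π := π) Hy) as Hy'.
    apply act_eq_img; [apply is_set_transport; exact Hy|apply is_set_transport; exact Hy'|].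
    intros z; rewrite in_code by exact Hy'; split.
    + intros [(u & Hu & ->)| ->].
      * apply in_act in Hu; [|exact Hy]. destruct Hu as (v & Hv & ->).
        exists (code v); split; [apply in_code; eauto|symmetry; auto].
      * exists marker; split; [apply in_code; auto|auto].
    + intros (u & Hu & ->). apply in_code in Hu; [|exact Hy]. destruct Hu as [(v & Hv & ->)| ->].
      * left; exists (act π v); split; [apply mem_act; exact Hv|auto].
      * right; exact Em.
Qed.

Lemma inM_code y : inM y -> ker y ⊆ B -> inM (code y) /\ ker (code y) ⊆ E.
Proof.
  pattern y; revert y; apply mem_induction; [definability|]. intros y IH My Hk.
  destruct (classic (ur y)) as [Hy|Hy].
  - pose proof (code_ur Hy Hk) as H.
    split; [exact (proj2 (inM_maps Mf H))|exact (HfE H)].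
  - assert (IH' : forall u, u ∈ y -> inM (code u) /\ ker (code u) ⊆ E).
    { intros u Hu; apply IH; [exact Hu|exact (inM_mem My Hu)|].
      intros a Ha; exact (Hk a (ker_mem Hu Ha)). }
    assert (KE : ker (code y) ⊆ E).
    { intros a Ha; apply ker_set in Ha; [|apply is_set_transport; exact Hy].
      destruct Ha as (z & Hz & Ha); apply in_code in Hz; [|exact Hy].
      destruct Hz as [(u & Hu & ->)| ->]; [exact (proj2 (IH' u Hu) a Ha)|].
      destruct (ker_marker Ha). }
    split; [|exact KE]. apply inM_intro with (ker E).
    + intros z Hz; apply in_code in Hz; [|exact Hy].
      destruct Hz as [(u & Hu & ->)| ->]; [apply IH'; exact Hu|].
      apply inM_pure, ker_marker.
    + destruct (filter_inter (inM_symset My) (inM_symset Mf)) as (L & HL & H).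
      apply (symset_filter HL). intros π Hπ; destruct (H π Hπ) as [H1 H2].
      apply (in_symset HG) in H1, H2. rewrite act_code by apply H2.
      f_equal; apply H1.
    + apply inM_ker; exact ME.
    + intros a Ha; apply in_ker_set_of_ur; auto.
Qed.

End Encoding.

Arguments code f _ : clear implicits.

(** * The meaning in [U] of universality in the model *)

Lemma universal_val (N : M) : universal N ->
  is_set_of_ur (val N) /\
  forall B, inM B -> is_set_of_ur B ->
    exists f, inM f /\ is_function f /\ injective f /\
      (forall b, b ∈ B -> exists v, maps f b v) /\
      (forall b v, maps f b v -> ker v ⊆ val N).
Proof.
  intros [[HN HN'] HU'].
  assert (SN : is_set_of_ur (val N)).
  { split; [exact HN|]. intros a Ha; exact (HN' (mk (inM_mem (val_inM N) Ha)) Ha). }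
  split; [exact SN|]. intros B MB [SB UB].
  destruct (HU' (mk MB)) as (f & ((Rf & Ff) & _ & Df) & If & Vf).
  { split; [exact SB|]. intros a Ha; exact (UB _ Ha). }
  assert (L : forall x y, maps (val f) x y -> exists a b : M, x = val a /\ y = val b /\ maps f a b).
  { intros x y H; destruct (inM_maps (val_inM f) H) as [Mx My].
    exists (mk Mx), (mk My); repeat split; apply maps_val; exact H. }
  exists (val f); split; [apply val_inM|]. split; [split; [split|]|split; [|split]].
  - exact (proj1 Rf).
  - intros p Hp; destruct (proj2 Rf (mk (inM_mem (val_inM f) Hp)) Hp) as (a & b & H).
    exists (val a), (val b); apply is_opair_iff; exact (proj1 (is_opair_val _ _ _) H).
  - intros x y y' H H'. destruct (L _ _ H) as (a & b & -> & -> & K).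
    destruct (L _ _ H') as (a' & b' & Ea & -> & K'). apply val_inj in Ea; subst a'.
    rewrite (Ff a b b' K K'); reflexivity.
  - intros x x' y H H'. destruct (L _ _ H) as (a & b & -> & -> & K).
    destruct (L _ _ H') as (a' & b' & -> & Eb & K'). apply val_inj in Eb; subst b'.
    rewrite (If a a' b K K'); reflexivity.
  - intros b Hb; destruct (proj1 (Df (mk (inM_mem MB Hb))) Hb) as (v & Hv).
    exists (val v); exact (proj1 (maps_val f _ v) Hv).
  - intros x y H a Ha. destruct (L _ _ H) as (b & v & -> & -> & K).
    destruct (@in_V_transitive M model_ZFU N v (conj HN HN') (Vf b v K))
      as (t & [St Tt] & Hvt & Ut).
    apply in_ker in Ha; destruct Ha as [Ha Ua].
    assert (Tt' : transitive (val t)).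
    { split; [exact St|]. intros y Hy z Hz.
      pose (y' := mk (inM_mem (val_inM t) Hy)).
      exact (Tt y' Hy (mk (inM_mem (val_inM y') Hz)) Hz). }
    pose proof (TC_min Tt' Hvt Ha) as Hat.
    exact (Ut (mk (inM_mem (val_inM t) Hat)) Hat Ua).
Qed.

(** ** The small violations of choice *)

Lemma transitive_val (x : M) : transitive (val x) -> transitive x.
Proof. intros [H1 H2]; split; [exact H1|]. intros y Hy z Hz; exact (H2 _ Hy _ Hz). Qed.

Lemma model_is_prod (d x y : M) : val d = prod (val x) (val y) -> is_prod d x y.
Proof.
  intros E; split.
  - change (is_set (val d)); rewrite E; apply is_set_prod.
  - intros p; change (p ∈ d) with (val p ∈ val d); rewrite E, in_prod; split.
    + intros (a & b & Ha & Hb & Hp).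
      exists (mk (inM_mem (val_inM x) Ha)), (mk (inM_mem (val_inM y) Hb)).
      split; [exact Ha|split; [exact Hb|]]. apply is_opair_val; exact Hp.
    + intros (a & b & Ha & Hb & Hp). exists (val a), (val b).
      split; [exact Ha|split; [exact Hb|]]. apply is_opair_val; exact Hp.
Qed.

Lemma model_function_on (g d : M) :
  is_set (val g) -> is_set (val d) ->
  (forall p, p ∈ val g -> exists a b, a ∈ val d /\ p = opair a b) ->
  (forall a b b', maps (val g) a b -> maps (val g) a b' -> b = b') ->
  (forall a, a ∈ val d -> exists b, maps (val g) a b) ->
  function_on g d.
Proof.
  intros Hg Hd Hp Hfun Htot; split; [split; [split; [exact Hg|]|]|split; [exact Hd|]].
  - intros p Pp; destruct (Hp (val p) Pp) as (a & b & Ha & E).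
    destruct (@inM_opair_inv a b) as [Ma Mb]; [rewrite <- E; apply val_inM|].
    exists (mk Ma), (mk Mb); apply is_opair_val; exact E.
  - intros a b b' H H'; apply val_inj, (Hfun (val a)); apply maps_val; assumption.
  - intros a; split.
    + intros Ha; destruct (Htot (val a) Ha) as (b & Hb).
      exists (mk (proj2 (inM_maps (val_inM g) Hb))); apply maps_val; exact Hb.
    + intros (b & Hb); apply maps_val, maps_iff in Hb.
      destruct (Hp _ Hb) as (a' & b' & Ha & E); apply opair_inj in E.
      destruct E as [E _]. change (val a ∈ val d); rewrite E; exact Ha.
Qed.

Section Cover.
Context {S x y0 L : U}.
Context (MS : inM S) (Mx : inM x) (Hy0 : y0 ∈ x).
Context (j : U -> U)
  (j_inj : forall y y', y ∈ x -> y' ∈ x -> j y = j y' -> y = y')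
  (j_rep : forall y, y ∈ x -> exists t, t ∈ S /\ symset G t = symset G (j y)).
Context (HL : L ∈ F) (Lj : forall π y, π ∈ L -> act π (j y) = j (act π y))
  (LS : forall π, π ∈ L -> act π S = S) (Lx : forall π, π ∈ L -> act π x = x)
  (Ly0 : forall π, π ∈ L -> act π y0 = y0).
Context {o : U} {h : U -> U} (Ho : is_ordinal o) (Dh : definable (fun e => e 0 = h (e 1))).

Context (h_pair : forall i, i ∈ o -> exists y t, y ∈ x /\ t ∈ S /\
           symset G t = symset G (j y) /\ h i = opair y t)
  (h_onto : forall y t, y ∈ x -> t ∈ S -> symset G t = symset G (j y) ->
           exists i, i ∈ o /\ h i = opair y t).

(* If [h i = (y, t)], the orbit of [t] in [S × {i}] is mapped to [x] by [π t ↦ π y]. *)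
Definition orbit_value s i v : Prop :=
  exists π y t, π ∈ L /\ h i = opair y t /\ acts π t s /\ acts π y v.

Lemma definable_h t : definable_term t -> definable_term (fun e => h (t e)).
Proof. apply definable_fun1; exact Dh. Qed.
Hint Resolve definable_h : definability.

Lemma definable_orbit_value t s r :
  definable_term t -> definable_term s -> definable_term r ->
  definable (fun e => orbit_value (t e) (s e) (r e)).
Proof. intros; unfold orbit_value; definability. Qed.
Hint Resolve definable_orbit_value : definability.

Lemma stabilizer_group : permutation_group A L.
Proof. exact (proj1 (nf_subgroup HF HL)). Qed.

(** [orbit_value] is phrased with [acts] because [π] is quantified there, while definability of
    [act] was established for a fixed [π]; on members of [L] the two agree. *)
Lemma orbit_value_iff s i v : i ∈ o ->
  orbit_value s i v <-> exists π y t, π ∈ L /\ y ∈ x /\ t ∈ S /\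
    symset G t = symset G (j y) /\ h i = opair y t /\ s = act π t /\ v = act π y.
Proof.
  intros Hi; split.
  - intros (π & y & t & Hπ & Hh & H1 & H2).
    destruct (h_pair Hi) as (y' & t' & Hy & Ht & Hs & Hh').
    rewrite Hh in Hh'; apply opair_inj in Hh'; destruct Hh'; subst y' t'.
    pose proof (group_function stabilizer_group Hπ) as Fπ.
    apply (acts_iff _ _ Fπ) in H1, H2. exists π, y, t; repeat split; auto.
  - intros (π & y & t & Hπ & _ & _ & _ & Hh & -> & ->).
    pose proof (group_function stabilizer_group Hπ) as Fπ.
    exists π, y, t; repeat split; auto; apply (acts_iff _ _ Fπ); reflexivity.
Qed.

Lemma orbit_value_range s i v : i ∈ o -> orbit_value s i v -> s ∈ S /\ v ∈ x.
Proof.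
  intros Hi H; apply (orbit_value_iff _ _ Hi) in H.
  destruct H as (π & y & t & Hπ & Hy & Ht & _ & _ & -> & ->).
  split; apply act_fixed_mem; auto.
Qed.

(** If [π] and [π'] agree on [t], then the inverse of [π'] composed with [π] stabilizes [t], hence
    [j y]. As [j] commutes with [L] and is injective on [x], this permutation fixes [y], so [π] and
    [π'] agree on [y]. *)
Lemma orbit_value_unique s i v v' :
  i ∈ o -> orbit_value s i v -> orbit_value s i v' -> v = v'.
Proof.
  intros Hi H H'; apply (orbit_value_iff _ _ Hi) in H, H'.
  destruct H as (π & y & t & Hπ & Hy & Ht & Hs & Hh & Es & ->).
  destruct H' as (π' & y' & t' & Hπ' & _ & _ & _ & Hh' & Es' & ->).
  rewrite Hh in Hh'; apply opair_inj in Hh'; destruct Hh'; subst y' t'.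
  destruct (group_inv stabilizer_group Hπ') as (i' & _ & Hi' & E1 & E2).
  destruct (group_comp stabilizer_group Hi' Hπ) as (ρ & _ & Hρ & Eρ).
  assert (Et : act ρ t = t) by (rewrite Eρ, <- Es, Es', E1; reflexivity).
  assert (Hρt : ρ ∈ symset G (j y)).
  { rewrite <- Hs; apply (in_symset HG); split; [exact (filter_mem_group HL Hρ)|exact Et]. }
  apply (in_symset HG) in Hρt; destruct Hρt as [_ Ej]. rewrite Lj in Ej by exact Hρ.
  apply j_inj in Ej; [|apply act_fixed_mem; auto|exact Hy].
  rewrite Eρ in Ej. rewrite <- (E2 (act π y)), Ej; reflexivity.
Qed.

Lemma act_orbit_value σ s i v : σ ∈ L -> i ∈ o ->
  orbit_value s i v -> orbit_value (act σ s) i (act σ v).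
Proof.
  intros Hσ Hi H; apply (orbit_value_iff _ _ Hi) in H; apply (orbit_value_iff _ _ Hi).
  destruct H as (π & y & t & Hπ & Hy & Ht & Hs & Hh & -> & ->).
  destruct (group_comp stabilizer_group Hσ Hπ) as (ρ & _ & Hρ & Eρ).
  exists ρ, y, t; rewrite !Eρ; repeat split; auto.
Qed.

(** SVC asks for a function on the whole product. Pairs outside the orbits get the default [y0],
    which [L] fixes, so the extended map remains symmetric. *)
Definition cover_value s i v : Prop :=
  orbit_value s i v \/ (~ (exists v', orbit_value s i v') /\ v = y0).

Definition cover : U := sep (prod (prod S o) x)
  (fun p => exists s i v, p = opair (opair s i) v /\ cover_value s i v).

Lemma definable_cover_pred :
  definable (fun e => exists s i v, e 0 = opair (opair s i) v /\ cover_value s i v).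
Proof. unfold cover_value; definability. Qed.

Lemma in_cover p : p ∈ cover <-> exists s i v,
  s ∈ S /\ i ∈ o /\ v ∈ x /\ p = opair (opair s i) v /\ cover_value s i v.
Proof.
  unfold cover; rewrite in_sep by exact definable_cover_pred; split.
  - intros (H & s & i & v & -> & Hv). rewrite !opair_in_prod in H.
    exists s, i, v; tauto.
  - intros (s & i & v & Hs & Hi & Hv & -> & H). rewrite !opair_in_prod. split; [tauto|eauto 6].
Qed.

Lemma is_set_cover : is_set cover.
Proof. apply is_set_sep, definable_cover_pred. Qed.

Lemma maps_cover s i v :
  maps cover (opair s i) v <-> s ∈ S /\ i ∈ o /\ v ∈ x /\ cover_value s i v.
Proof.
  rewrite maps_iff, in_cover; split.
  - intros (s' & i' & v' & H1 & H2 & H3 & Eq & H4).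
    apply opair_inj in Eq; destruct Eq as [Eq <-]; apply opair_inj in Eq; destruct Eq; subst; auto.
  - intros (H1 & H2 & H3 & H4); exists s, i, v; auto.
Qed.

Lemma cover_value_unique s i v v' :
  i ∈ o -> cover_value s i v -> cover_value s i v' -> v = v'.
Proof.
  intros Hi [H|[N ->]] [H'|[N' ->]]; [|destruct N'; eauto|destruct N; eauto|reflexivity].
  exact (orbit_value_unique Hi H H').
Qed.

Lemma cover_value_total s i : i ∈ o -> exists v, v ∈ x /\ cover_value s i v.
Proof.
  intros Hi; destruct (classic (exists v, orbit_value s i v)) as [(v & Hv)|N].
  - exists v; split; [apply (orbit_value_range Hi Hv)|left; exact Hv].
  - exists y0; split; [exact Hy0|right; auto].
Qed.

Lemma act_cover_value σ s i v : σ ∈ L -> i ∈ o ->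
  cover_value s i v -> cover_value (act σ s) i (act σ v).
Proof.
  intros Hσ Hi [H|[N ->]]; [left; apply act_orbit_value; assumption|right].
  (* A value at [act σ s] would be carried back by the inverse of [σ] to a value at [s]. *)
  split; [|apply Ly0; exact Hσ]. intros (v' & Hv'); apply N.
  destruct (group_inv stabilizer_group Hσ) as (τ & _ & Hτ & Eτ & _).
  exists (act τ v'). rewrite <- (Eτ s). apply act_orbit_value; assumption.
Qed.

Lemma inM_cover : inM cover.
Proof.
  apply inM_intro with (cup (ker S) (ker x)).
  - intros p Hp; apply in_cover in Hp; destruct Hp as (s & i & v & Hs & Hi & Hv & -> & _).
    apply inM_opair; [apply inM_opair; [exact (inM_mem MS Hs)|]|exact (inM_mem Mx Hv)].
    apply inM_pure, ker_ordinal, (ordinal_mem Ho Hi).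
  - apply (symset_filter_closed HL is_set_cover). intros π p Hπ Hp.
    apply in_cover in Hp; apply in_cover. destruct Hp as (s & i & v & Hs & Hi & Hv & -> & H).
    exists (act π s), i, (act π v). rewrite !act_opair, (act_ordinal π (ordinal_mem Ho Hi)).
    repeat split; auto using act_fixed_mem, act_cover_value.
  - apply ideal_cup; apply inM_ker; assumption.
  - intros a Ha; apply ker_set in Ha; [|apply is_set_cover]. destruct Ha as (p & Hp & Ha).
    apply in_cover in Hp; destruct Hp as (s & i & v & Hs & Hi & Hv & -> & _).
    rewrite !ker_opair in Ha; apply in_cup. destruct Ha as [[Ha|Ha]|Ha].
    + left; exact (ker_mem Hs Ha).
    + destruct (ker_ordinal (ordinal_mem Ho Hi) Ha).
    + right; exact (ker_mem Hv Ha).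
Qed.

Lemma cover_onto v : v ∈ x -> exists s i, maps cover (opair s i) v.
Proof.
  intros Hv; destruct (j_rep Hv) as (t & Ht & Hs).
  destruct (h_onto Hv Ht Hs) as (i & Hi & Hh).
  (* The identity of [L] puts the listed pair itself into its orbit. *)
  destruct (group_id stabilizer_group) as (ι & Hι & Eι).
  exists t, i; apply maps_cover; repeat split; auto.
  left; apply (orbit_value_iff _ _ Hi). exists ι, v, t; rewrite !Eι; repeat split; auto.
Qed.

Lemma model_cover (S' x' : M) : val S' = S -> val x' = x ->
  exists α d g : M, is_ordinal α /\ is_prod d S' α /\ function_on g d /\ onto g x'.
Proof.
  intros ES Ex.
  assert (Mo : inM o) by (apply inM_pure, ker_ordinal, Ho).
  exists (mk Mo), (mk (inM_prod MS Mo)), (mk inM_cover).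
  split; [|split; [|split]].
  - split; [apply transitive_val; exact (proj1 Ho)|].
    intros y Hy; apply transitive_val; exact (proj2 Ho _ Hy).
  - apply model_is_prod; rewrite ES; reflexivity.
  - apply model_function_on.
    + exact is_set_cover.
    + apply is_set_prod.
    + intros p Hp; apply in_cover in Hp; destruct Hp as (s & i & v & Hs & Hi & Hv & -> & _).
      exists (opair s i), v; split; [apply opair_in_prod; auto|reflexivity].
    + intros a b b' H H'. assert (Ha : exists s i, a = opair s i).
      { apply maps_iff, in_cover in H; destruct H as (s & i & v & _ & _ & _ & Eq & _).
        apply opair_inj in Eq; destruct Eq; eauto. }
      destruct Ha as (s & i & ->). apply maps_cover in H, H'.
      apply (@cover_value_unique s i); tauto.
    + intros a Ha; apply in_prod in Ha; destruct Ha as (s & i & Hs & Hi & ->).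
      destruct (cover_value_total s Hi) as (v & Hv & H). exists v; apply maps_cover; auto.
  - intros v; change (v ∈ x') with (val v ∈ val x'); rewrite Ex; split.
    + intros Hv; destruct (cover_onto Hv) as (s & i & H).
      exists (mk (proj1 (inM_maps inM_cover H))); apply maps_val; exact H.
    + intros (a & Ha); apply maps_val, maps_iff, in_cover in Ha.
      destruct Ha as (s & i & v' & _ & _ & Hv & Eq & _).
      apply opair_inj in Eq; destruct Eq as [_ ->]; exact Hv.
Qed.

End Cover.

Theorem model_SVC : AC U -> has_universal_set M -> SVC M.
Proof.
  intros HAC (N & HN). destruct (universal_val HN) as [HE Henc].
  pose proof (val_inM N) as ME.
  destruct (stabilizer_representatives ME HE) as (S & MS & SS & HS).
  exists (mk MS); split; [exact SS|]. intros x Sx.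
  destruct (classic (exists y, y ∈ val x)) as [(y0 & Hy0)|Nx].
  2: { left; split; [exact Sx|]. intros z Hz; apply Nx; exists (val z); exact Hz. }
  right. pose proof (val_inM x) as Mx.
  destruct (Henc (ker (val x)) (inM_kernel Mx)) as (f & Mf & Ff & If & HB & HfE).
  { split; [apply is_set_ker|]. intros a Ha; apply in_ker in Ha; tauto. }
  destruct (filter_inter (inM_symset Mx) (inM_symset Mf)) as (L1 & HL1 & H1).
  (* The group [L] must also fix the default value [y0], whose stabilizer is in the filter because
     [y0] is a member of [x]. *)
  destruct (filter_inter (inM_symset MS) (inM_symset (inM_mem Mx Hy0))) as (L2 & HL2 & H2).
  destruct (filter_inter HL1 HL2) as (L & HL & H).
  assert (HLG : forall π, π ∈ L -> π ∈ G) by (intros π; apply (filter_mem_group HL)).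
  assert (Lfix : forall π, π ∈ L ->
    act π (val x) = val x /\ act π f = f /\ act π S = S /\ act π y0 = y0).
  { intros π Hπ; destruct (H π Hπ) as [K1 K2]; apply H1 in K1; apply H2 in K2.
    rewrite !(in_symset HG) in K1, K2; tauto. }
  set (j := code f).
  set (P := fun p => exists y t, p = opair y t /\ symset G t = symset G (j y)).
  assert (DP : definable (fun e => P (e 0))).
  { unfold P, j; pose proof (@definable_code f); definability. }
  set (Z := sep (prod (val x) S) P).
  assert (HZ : forall y t, opair y t ∈ Z <-> y ∈ val x /\ t ∈ S /\ symset G t = symset G (j y)).
  { intros y t; unfold Z; rewrite in_sep by exact DP; rewrite opair_in_prod; unfold P; split.
    - intros [[Hy Ht] (y' & t' & Eq & Hs)]; apply opair_inj in Eq; destruct Eq; subst; auto.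
    - intros (Hy & Ht & Hs); eauto 6. }
  (* The listing [h] is a class function of [U] with no symmetry of its own: for each [i] the cover
     uses the whole orbit of [h i] under [L]. *)
  destruct (AC_ordinal_surjection Z HAC) as (o & h & Ho & Dh & hZ & Zh).
  assert (Hk : forall y, y ∈ val x -> ker y ⊆ ker (val x)) by (intros y; apply ker_mem).
  apply (@model_cover S (val x) y0 L MS Mx Hy0 j) with (o := o) (h := h);
    try (intros π Hπ; apply (Lfix π Hπ)); auto.
  - intros y y' Hy Hy'; apply (code_inj Ff If HB); apply Hk; assumption.
  - intros y Hy. destruct (inM_code ME HE Mf Ff HB HfE (inM_mem Mx Hy) (Hk y Hy)).
    apply HS; assumption.
  - intros π y Hπ; apply (act_code Ff); [exact (HLG π Hπ)|apply (Lfix π Hπ)].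
  - intros i Hi; pose proof (hZ i Hi) as Hz. unfold Z in Hz; rewrite in_sep in Hz by exact DP.
    destruct Hz as (Hz & y & t & Eh & Hs); rewrite Eh in Hz; apply opair_in_prod in Hz.
    exists y, t; tauto.
  - intros y t Hy Ht Hs. destruct (Zh (opair y t)) as (i & Hi & Eh); [apply HZ; auto|].
    exists i; auto.
Qed.

End Model.

Theorem theorem3p3 (U : structure) (A G F I : U)
  (HU : ZFU U)
  (HG : permutation_group A G)
  (HF : normal_filter A G F)
  (HI : flexible_ideal G I) :
  ZFU (small_kernel_model G F I) /\
  (AC U ->
   has_universal_set (small_kernel_model G F I) ->
   SVC (small_kernel_model G F I)).
Proof.
  split; [exact (model_ZFU HG HF HI)|exact (model_SVC HG HF HI)].
Qed.
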